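(* Let $\Phi:\mathbb R\to\mathbb R$ be a $2\pi$-periodic bounded function that is differentiable a.e. Then $\mathbb V_{\Phi}(z)$ has a finite limit $\varphi(\zeta)$ as $z\to\zeta$ along all nontangential paths in $\mathbb D$ to a.e. $\zeta\in\partial\mathbb D$.
   Context: $\mathbb D=\{z\in\mathbb C:|z|<1\}$. For arbitrary functions $g,f$ on a compact interval $[a,b]$, the Riemann--Stieltjes integral $\int_a^b g\,df$ is the limit, as $\delta:=\max_k|t_k-t_{k-1}|\to0$, of the sums $\sum_{k=1}^p g(\tau_k)\,(f(t_k)-f(t_{k-1}))$ over partitions $a=t_0\le t_1\le\dots\le t_p=b$ and points $\tau_k\in[t_{k-1},t_k]$, provided a finite limit exists, uniform with respect to the partitions and the intermediate points (no monotonicity or bounded variation is assumed). The conjugate Poisson kernel is $Q_r(\Theta)=\dfrac{2r\sin\Theta}{1-2r\cos\Theta+r^2}$, $0\le r<1$. For a $2\pi$-periodic bounded $\Phi:\mathbb R\to\mathbb R$ whose set of discontinuities has measure zero, the conjugate Poisson--Stieltjes integral is the Riemann--Stieltjes integral $$\mathbb V_\Phi(z):=\frac1{2\pi}\int_{-\pi}^{\pi}Q_r(\vartheta-t)\,d\Phi(t),\qquad z=re^{i\vartheta},\ r<1 .$$ A path in $\mathbb D$ terminating at $\zeta\in\partial\mathbb D$ is nontangential if its part in a neighborhood of $\zeta$ lies inside an angle in $\mathbb D$ with vertex at $\zeta$. *)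

(* Defs.v *)
From HB Require Import structures.
From mathcomp Require Import all_boot all_order all_algebra.
From mathcomp Require Import all_classical all_reals all_analysis.
From mathcomp Require Import complex.

Set Implicit Arguments.
Unset Strict Implicit.
Unset Printing Implicit Defensive.

Import Order.TTheory GRing.Theory Num.Theory.
Import numFieldNormedType.Exports.

Local Open Scope classical_set_scope.
Local Open Scope ring_scope.
Local Open Scope complex_scope.

(* Points of C are elements of R[i]; the alias R[i]^o is the same type carrying
   the topology of the modulus.  The order on R[i] compares numbers with equal
   imaginary parts, so `|z| < 1 has its usual meaning. *)

Section RiemannStieltjes.
Context {R : realType}.
Implicit Types (g f : R -> R) (a b : R).

(* Only the values t 0, ..., t p and tau 0, ..., tau (p - 1) matter; consecutive
   t k may coincide. *)
Definition tagged_partition a b (p : nat) (t tau : nat -> R) : Prop :=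
  [/\ t 0%N = a, t p = b
    & forall k, (k < p)%N -> t k <= tau k <= t k.+1].

Definition is_RSint g f a b (l : R) : Prop :=
  forall e : R, 0 < e -> exists2 d : R, 0 < d &
    forall (p : nat) (t tau : nat -> R), tagged_partition a b p t tau ->
      (forall k, (k < p)%N -> t k.+1 - t k < d) ->
      `|\sum_(k < p) g (tau k) * (f (t k.+1) - f (t k)) - l| < e.

Definition RSintegrable g f a b : Prop := exists l, is_RSint g f a b l.

(* The value is 0 when g is not integrable with respect to f. *)
Definition RSint g f a b : R := xget 0 [set l | is_RSint g f a b l].

End RiemannStieltjes.

Section ConjugatePoissonStieltjes.
Context {R : realType}.
Implicit Types (Phi : R -> R) (z zeta : R[i]) (r theta : R).

Definition expi theta : R[i] := cos theta +i* sin theta.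

Definition unit_disk : set R[i] := [set z | `|z| < 1].

Definition conj_poisson r theta : R :=
  2 * r * sin theta / (1 - 2 * r * cos theta + r ^+ 2).

(* Some theta with z = |z| e^(i theta).  The choice among the arguments of z is
   immaterial below: conj_poisson is 2 pi-periodic in the angle, and vanishes
   for r = 0. *)
Definition carg z : R := xget 0 [set theta | z = `|z| * expi theta].

Definition conj_poisson_stieltjes Phi z : R :=
  (2 * pi)^-1 *
  RSint (fun t => conj_poisson (complex.Re `|z|) (carg z - t)) Phi (- pi) pi.

Definition path_to (gamma : R -> R[i]^o) zeta : Prop :=
  [/\ {within `[0, 1], continuous gamma},
      (forall s : R, 0 <= s < 1 -> unit_disk (gamma s))
    & gamma 1 = zeta].

Definition sector zeta (rho0 psi1 psi2 : R) : set R[i] :=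
  [set z | exists rho psi : R,
    [/\ 0 < rho < rho0, psi1 < psi < psi2 & z = zeta + rho%:C * expi psi]].

(* An angle with vertex zeta is truncated at some radius; a truncated angle with
   vertex on the unit circle is contained in the disk only if its sides are not
   tangent to the circle. *)
Definition nontangential (gamma : R -> R[i]^o) zeta : Prop :=
  exists rho0 psi1 psi2 : R, sector zeta rho0 psi1 psi2 `<=` unit_disk /\
    \forall z \near (zeta : R[i]^o),
      (gamma @` `[0, 1[) z -> sector zeta rho0 psi1 psi2 z.

(* Almost everywhere on the unit circle with respect to arc length: a set of
   points of the circle is null iff the set of all their arguments is Lebesgue
   null. *)
Definition circle_ae (P : R[i] -> Prop) : Prop :=
  {ae (@lebesgue_measure R), forall theta, P (expi theta)}.

End ConjugatePoissonStieltjes.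

(* Main.v *)
(* Integration by parts turns the conjugate Poisson-Stieltjes integral of Phi into the integral
   of Phi against K_r = Q_r'.  Let E_N be the closed set of x with |Phi y - Phi x| <= N |y - x|
   for all y; by boundedness the E_N cover all points of differentiability.  Extend Phi from E_N
   to a Lipschitz periodic G (McShane).  The remainder Phi - G is O(|t - x|) for every x in E_N,
   so a Marcinkiewicz integral gives, for almost every x in E_N, an integrable majorant of
   (Phi - G) / |x - t|^2; as K_r = O(|x - t|^-2) in a Stolz angle at e^(ix), dominated convergence
   applies to this part.  For G, duality with trigonometric polynomials shows that the formally
   differentiated conjugate Fourier series of G is square summable; it therefore converges in L2,
   along a subsequence dominatedly almost everywhere, to some v whose Poisson integral is the
   integral of G against K_r, and Fatou's theorem holds at the Lebesgue points of v. *)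
Require Import Defs.
From HB Require Import structures.
From mathcomp Require Import all_boot all_order all_algebra.
From mathcomp Require Import all_classical all_reals all_analysis.
From mathcomp Require Import complex.
From mathcomp Require Import measurable_realfun.
From mathcomp Require Import ring lra.
Set Implicit Arguments.
Unset Strict Implicit.
Unset Printing Implicit Defensive.
Import Order.TTheory GRing.Theory Num.Theory.
Import numFieldNormedType.Exports.
Local Open Scope classical_set_scope.
Local Open Scope ring_scope.

Section RealIntegrals.
Context {R : realType}.
Notation mu := (@lebesgue_measure R).
Implicit Types (f g F : R -> R) (a b : R) (D : set R).

Lemma lebesgue_ae_imply (P Q : R -> Prop) : (forall x, P x -> Q x) ->
  {ae mu, forall x, P x} -> {ae mu, forall x, Q x}.
Proof. by move=> PQ; apply: filterS; [exact: (ae_filter_ringOfSetsType mu)|]. Qed.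

Lemma lebesgue_ae_and (P Q : R -> Prop) : {ae mu, forall x, P x} ->
  {ae mu, forall x, Q x} -> {ae mu, forall x, P x /\ Q x}.
Proof.
by move=> hP hQ; apply: filterS2 hP hQ; [exact: (ae_filter_ringOfSetsType mu)|].
Qed.

Lemma eq_is_derive f g (x df dg : R) : is_derive x 1 f df ->
  (forall y, f y = g y) -> df = dg -> is_derive x 1 g dg.
Proof. by move=> h /funext <- <-. Qed.

Lemma continuous_segment_integrable f a b :
  continuous f -> mu.-integrable `[a, b] (EFin \o f).
Proof.
move=> cf; apply: continuous_compact_integrable; first exact: segment_compact.
by apply: continuous_subspaceT => x; exact: cf.
Qed.

Lemma continuous_measurable D f : continuous f -> measurable_fun D f.
Proof. by move=> cf; apply: measurable_funTS; exact: continuous_measurable_fun. Qed.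

Lemma Rintegral_FTC2 F f a b : a <= b -> continuous f ->
  (forall x : R, is_derive x 1 F (f x)) ->
  \int[mu]_(x in `[a, b]) f x = F b - F a.
Proof.
rewrite le_eqVlt => /predU1P[<- _ _|ab cf dF].
  by rewrite set_itv1 Rintegral_set1 subrr.
have cF : continuous F.
  by move=> x; apply/differentiable_continuous/derivable1_diffP.
rewrite /Rintegral (@continuous_FTC2 _ f F)//.
- by apply: continuous_subspaceT => x; exact: cf.
- split.
  + by move=> x _.
  + exact/cvg_at_right_filter/cF.
  + exact/cvg_at_left_filter/cF.
- by move=> x _; rewrite derive1E; apply: derive_val.
Qed.

Lemma Rdominated_convergence D (f_ : (R -> R)^nat) f g : measurable D ->
  (forall n, measurable_fun D (f_ n)) -> measurable_fun D f ->
  {ae mu, forall x, D x -> f_ n x @[n --> \oo] --> f x} ->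
  mu.-integrable D (EFin \o g) ->
  {ae mu, forall x n, D x -> `|f_ n x| <= g x} ->
  [/\ mu.-integrable D (EFin \o f),
      (\int[mu]_(x in D) `|f_ n x - f x|) @[n --> \oo] --> (0 : R) &
      (\int[mu]_(x in D) f_ n x) @[n --> \oo] --> \int[mu]_(x in D) f x].
Proof.
move=> mD mf_ mf ff ig fg.
have h1 n : measurable_fun D (EFin \o f_ n) by exact/measurable_EFinP.
have h2 : measurable_fun D (EFin \o f) by exact/measurable_EFinP.
have h3 : {ae mu, forall x, D x -> (EFin \o f_ n) x @[n --> \oo] --> (EFin \o f) x}.
  apply: lebesgue_ae_imply ff => x + Dx => /(_ Dx) h; apply: cvg_EFin; last exact: h.
  exact: nearW.
have h4 : {ae mu, forall x n, D x -> (`|(EFin \o f_ n) x| <= (EFin \o g) x)%E}.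
  by apply: lebesgue_ae_imply fg => x + n Dx => /(_ n Dx); rewrite lee_fin.
have [fi c1 c2] :=
  @dominated_convergence _ _ _ mu D mD (fun n => EFin \o f_ n) _ _ h1 h2 h3 ig h4.
split => //.

  by move/fine_cvg : c1.
by move: c2; rewrite -[X in _ --> X]fineK; [move/fine_cvg|exact: integrable_fin_num].
Qed.

Lemma negligible_translate (N : set R) c :
  mu.-negligible N -> mu.-negligible [set x | N (x - c)].
Proof.
case=> M [mM M0 NM].
have mt : measurable_fun setT (fun x : R => x - c).
  by apply: measurable_funB => //; exact: measurable_cst.
exists ((fun x => x - c) @^-1` M); split.
- by rewrite -[X in measurable X]setTI; exact: mt.
- transitivity (pushforward mu (fun x => x - c : measurableTypeR R) M); first by [].
  rewrite -[RHS]M0; apply/esym/lebesgue_measure_unique => //= _ [[a b]] _ <-.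
  rewrite /pushforward (_ : _ @^-1` _ = `](a + c), (b + c)]%classic) //.
    rewrite !lebesgue_measure_itv /= !lte_fin ltrD2r; case: ifP => // _.
    by rewrite -!EFinB; congr EFin; ring.
  by apply/seteqP; split => x /=; rewrite !in_itv /= ltrBrDr lerBlDr.
- by move=> x /= /NM.
Qed.

Lemma measurable_inv : measurable_fun setT (@GRing.inv R).
Proof.
rewrite -(setUv [set 0 : R]); apply/measurable_funU => //.
  exact: measurableC.
split; first exact: measurable_fun_set1.
apply: open_continuous_measurable_fun; first exact/closed_openC/closed_eq.
by move=> x /set_mem /= /eqP x0; exact: inv_continuous.
Qed.

Lemma eq_Rintegrable D f g : measurable D -> (forall x, D x -> f x = g x) ->
  mu.-integrable D (EFin \o f) -> mu.-integrable D (EFin \o g).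
Proof.
move=> mD fg; apply: eq_integrable => // x /set_mem Dx.
by rewrite /= fg.
Qed.

Lemma RintegrableD D f g : measurable D -> mu.-integrable D (EFin \o f) ->
  mu.-integrable D (EFin \o g) -> mu.-integrable D (EFin \o (fun x => f x + g x)).
Proof.
move=> mD fi gi; have := @integrableD _ _ _ mu D mD _ _ fi gi.
by apply: eq_integrable => // x _; rewrite /= EFinD.
Qed.

Lemma RintegrableB D f g : measurable D -> mu.-integrable D (EFin \o f) ->
  mu.-integrable D (EFin \o g) -> mu.-integrable D (EFin \o (fun x => f x - g x)).
Proof.
move=> mD fi gi; have := @integrableB _ _ _ mu D mD _ _ fi gi.
by apply: eq_integrable => // x _; rewrite /= EFinB.
Qed.

Lemma RintegrableZl D (k : R) f : measurable D -> mu.-integrable D (EFin \o f) ->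
  mu.-integrable D (EFin \o (fun x => k * f x)).
Proof.
move=> mD fi; have := @integrableZl _ _ _ mu D mD k _ fi.
by apply: eq_integrable => // x _; rewrite /= EFinM.
Qed.

Lemma le_ae_Rintegrable D f g : measurable D -> measurable_fun D f ->
  {ae mu, forall x, D x -> `|f x| <= g x} -> mu.-integrable D (EFin \o g) ->
  mu.-integrable D (EFin \o f).
Proof.
move=> mD mf fg gi; have [] := @Rdominated_convergence D (fun=> f) f g => //.
  by apply: aeW => x Dx; exact: cvg_cst.
by apply: lebesgue_ae_imply fg => x + _.
Qed.

Lemma Rintegrable_bddM D f g (M : R) : measurable D -> measurable_fun D f ->
  (forall x, D x -> `|f x| <= M) -> mu.-integrable D (EFin \o g) ->
  mu.-integrable D (EFin \o (fun x => f x * g x)).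
Proof.
move=> mD mf fM gi; apply: (@le_ae_Rintegrable _ _ (fun x => M * `|g x|)) => //.
- apply: measurable_funM => //.
  by apply/measurable_EFinP; exact: measurable_int gi.
- by apply: aeW => x Dx; rewrite normrM ler_wpM2r// fM.
- by apply: RintegrableZl => //; exact: (integrable_norm gi).
Qed.

Lemma Rintegral_sum D (h : nat -> R -> R) n : measurable D ->
  (forall k, (k < n)%N -> mu.-integrable D (EFin \o h k)) ->
  mu.-integrable D (EFin \o (fun x => \sum_(k < n) h k x)) /\
  \int[mu]_(x in D) (\sum_(k < n) h k x) = \sum_(k < n) \int[mu]_(x in D) h k x.
Proof.
move=> mD; elim: n => [|n IHn] hi.
  split.
    rewrite (_ : _ \o _ = cst 0%E); first exact: integrable0.
    by apply/funext => x /=; rewrite big_ord0.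
  rewrite big_ord0 -[RHS](mul0r (fine (mu D))) -Rintegral_cst//.
  by apply: eq_Rintegral => x _; rewrite big_ord0.
have [|i1 e1] := IHn; first by move=> k kn; apply: hi; exact: ltnW.
have hn := hi n (ltnSn n).
split.
  apply: eq_Rintegrable mD _ (RintegrableD mD i1 hn) => x _.
  by rewrite big_ord_recr.
rewrite big_ord_recr /= -e1 -RintegralD//.
by apply: eq_Rintegral => x _; rewrite big_ord_recr.
Qed.
End RealIntegrals.

Section RiemannStieltjesByParts.
Context {R : realType}.
Notation mu := (@lebesgue_measure R).
Implicit Types (f g : R -> R) (a b : R) (t tau s : nat -> R).

Lemma sum_step_eq s (c : nat -> R) n k x : {homo s : i j / (i <= j)%N >-> i <= j} ->
  (k < n)%N -> s k < x <= s k.+1 ->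
  \sum_(j < n) c j * \1_(`]s j, s j.+1]%classic) x = c k.
Proof.
move=> sh kn /andP[kx xk]; rewrite (bigD1 (Ordinal kn)) //= big1 ?addr0.
  by rewrite indicE mem_set ?mulr1//= in_itv /= kx.
move=> j jk; rewrite indicE memNset ?mulr0//= in_itv /= => /andP[jx xj].
have [jk'|kj] : (j < k)%N \/ (k < j)%N.
  by apply/orP; rewrite -neq_ltn.
- by move: (lt_le_trans kx xj); rewrite ltNge sh.
- by move: (lt_le_trans jx xk); rewrite ltNge sh.
Qed.

Lemma step_cover s n x : s 0%N < x <= s n ->
  exists2 k, (k < n)%N & s k < x <= s k.+1.
Proof.
elim: n => [|n IHn] /andP[s0 xn].
  by move: (lt_le_trans s0 xn); rewrite ltxx.
have [xn'|nx] := leP x (s n).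
  by have [|k kn ?] := IHn; [rewrite s0|exists k => //; exact: ltnW].
by exists n => //; rewrite nx.
Qed.

(* The intermediate points are completed by a and b into a partition with tags t. *)
Definition tag_nodes a b p tau (k : nat) : R :=
  if k is k'.+1 then (if (k' < p)%N then tau k' else b) else a.

Lemma tag_nodes_sandwich a b p t tau k : tagged_partition a b p t tau ->
  (k <= p)%N -> tag_nodes a b p tau k <= t k <= tag_nodes a b p tau k.+1.
Proof.
move=> [t0 tp h] kp; apply/andP; split.
  case: k kp => [|k] kp /=; first by rewrite t0.
  by rewrite kp; have /andP[] := h k kp.
rewrite /=; case: ifPn => [kp'|]; first by have /andP[] := h k kp'.
by rewrite -leqNgt => pk; rewrite (_ : k = p) ?tp//; apply/eqP; rewrite eqn_leq kp.
Qed.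

Lemma tag_nodes_mesh a b p t tau k (d : R) : tagged_partition a b p t tau ->
  (forall k, (k < p)%N -> t k.+1 - t k < d) -> 0 < d -> (k <= p)%N ->
  t k - d <= tag_nodes a b p tau k /\ tag_nodes a b p tau k.+1 <= t k + d.
Proof.
move=> [t0 tp h] td d0 kp; split.
  case: k kp => [|k] kp /=; first by rewrite t0; lra.
  by rewrite kp; have := h k kp; have := td k kp; lra.
rewrite /=; case: ifPn => [kp'|].
  by have := h k kp'; have := td k kp'; lra.
rewrite -leqNgt => pk; rewrite (_ : k = p) ?tp; first by lra.
by apply/eqP; rewrite eqn_leq kp.
Qed.

Lemma tag_nodes_homo a b p t tau : tagged_partition a b p t tau ->
  {homo tag_nodes a b p tau : i j / (i <= j)%N >-> i <= j}.
Proof.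
move=> tp; apply: homo_leq => [x|x y z|k]; [exact: lexx|exact: le_trans|].
have [kp|pk] := leqP k p.
  by have /andP[/le_trans/[apply]] := tag_nodes_sandwich tp kp.
case: k pk => // k; rewrite ltnS => pk /=.
by rewrite !ltnNge pk (leq_trans pk).
Qed.

Lemma abel_RSsum f g a b p t tau : tagged_partition a b p t tau ->
  \sum_(k < p) g (tau k) * (f (t k.+1) - f (t k)) =
  g b * f b - g a * f a -
  \sum_(k < p.+1) f (t k) * (g (tag_nodes a b p tau k.+1) - g (tag_nodes a b p tau k)).
Proof.
move=> [t0 tp h].
under [X in _ = _ - X]eq_bigr do rewrite mulrBr.
rewrite sumrB [X in _ = _ - (X - _)]big_ord_recr [X in _ = _ - (_ - X)]big_ord_recl /=.
rewrite ltnn t0 tp.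
under [X in X = _]eq_bigr do rewrite mulrBr.
rewrite sumrB.
have -> : \sum_(i < p) f (t i) * g (if (i < p)%N then tau i else b) =
          \sum_(i < p) g (tau i) * f (t i).
  by apply: eq_bigr => i _; rewrite ltn_ord mulrC.
have -> : \sum_(i < p) f (t (bump 0 i)) * g (if (i < p)%N then tau i else b) =
          \sum_(i < p) g (tau i) * f (t i.+1).
  by apply: eq_bigr => i _; rewrite ltn_ord mulrC.
ring.
Qed.

Definition tag_step f a b p t tau (x : R) : R :=
  \sum_(k < p.+1) f (t k) *
    \1_(`]tag_nodes a b p tau k, tag_nodes a b p tau k.+1]%classic) x.

Lemma tag_stepP f a b p t tau x (d : R) : tagged_partition a b p t tau ->
  (forall k, (k < p)%N -> t k.+1 - t k < d) -> 0 < d -> a < x <= b ->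
  exists2 y, `|y - x| <= d & tag_step f a b p t tau x = f y.
Proof.
move=> tp td d0 axb.
have [|k kp xk] := @step_cover (tag_nodes a b p tau) p.+1 x; first by rewrite /= ltnn.
exists (t k); last by rewrite /tag_step (sum_step_eq (f \o t) (tag_nodes_homo tp) kp).
have [h1 h2] := tag_nodes_mesh tp td d0 kp.
by rewrite ler_norml; lra.
Qed.

Lemma measurable_tag_step f a b p t tau D : measurable_fun D (tag_step f a b p t tau).
Proof.
apply: measurable_sum => k; apply: measurable_funM; first exact: measurable_cst.
exact: measurable_indic.
Qed.

Lemma integral_tag_step f g g' a b p t tau : tagged_partition a b p t tau ->
  continuous g' -> (forall x : R, is_derive x 1 g (g' x)) ->
  \int[mu]_(x in `]a, b]) (tag_step f a b p t tau x * g' x) =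
  \sum_(k < p.+1) f (t k) * (g (tag_nodes a b p tau k.+1) - g (tag_nodes a b p tau k)).
Proof.
move=> tp cg dg; pose s := tag_nodes a b p tau.
have ig u v : mu.-integrable `]u, v] (EFin \o g').
  apply: (@integrableS _ _ _ mu `[u, v]) => //; last exact: continuous_segment_integrable.
  exact: subset_itv_oc_cc.
have sh := tag_nodes_homo tp.
have sub k : (k <= p)%N -> `]s k, s k.+1] `<=` `]a, b].
  move=> kp x /=; rewrite !in_itv /= => /andP[kx xk].
  rewrite (le_lt_trans _ kx) ?(le_trans xk)//=; last exact: (sh 0%N).
  by have := sh k.+1 p.+1; rewrite [X in _ <= X]/= ltnn; exact.
have ik k : (k < p.+1)%N -> mu.-integrable `]a, b]
    (EFin \o (fun x => f (t k) * (\1_(`]s k, s k.+1]%classic) x * g' x))).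
  move=> kp.
  apply: RintegrableZl => //; apply: (@eq_Rintegrable _ _ (g' \_ `]s k, s k.+1])) => //.
    by move=> x _; rewrite patchE indicE; case: (x \in _); rewrite ?(mul1r, mul0r).
  rewrite -restrict_EFin.
  by apply/integrable_restrict => //; rewrite setIidr//; exact: sub.
transitivity (\int[mu]_(x in `]a, b]) (\sum_(k < p.+1)
    f (t k) * (\1_(`]s k, s k.+1]%classic) x * g' x))).
  apply: eq_Rintegral => x _; rewrite mulr_suml.
  by apply: eq_bigr => k _; rewrite mulrA.
rewrite (Rintegral_sum _ ik).2//; apply: eq_bigr => -[k /= kp] _.
have {}sub := sub k kp.
have igk : mu.-integrable `]a, b] (EFin \o (g' \_ `]s k, s k.+1])).
  rewrite -restrict_EFin.
  by apply/integrable_restrict => //; rewrite setIidr.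
transitivity (\int[mu]_(x in `]a, b]) (f (t k) * (g' \_ `]s k, s k.+1]) x)).
  apply: eq_Rintegral => x _; congr (_ * _).
  by rewrite patchE indicE; case: (x \in _); rewrite ?(mul1r, mul0r).
rewrite RintegralZl// -Rintegral_mkcondr setIidr// Rintegral_itv_obnd_cbnd//.
by rewrite (Rintegral_FTC2 _ cg dg)//; exact: sh.
Qed.

Lemma RSint_by_parts f g g' a b (A : set R) (M : R) : a <= b ->
  measurable_fun setT (f \_ A) -> mu.-negligible (~` A) ->
  (forall x, A x -> {for x, continuous f}) -> (forall x, `|f x| <= M) ->
  continuous g' -> (forall x : R, is_derive x 1 g (g' x)) ->
  is_RSint g f a b
    (g b * f b - g a * f a - \int[mu]_(x in `[a, b]) ((f \_ A) x * g' x)).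
Proof.
move=> ab mf nA cf fM cg dg.
have ig : mu.-integrable `]a, b] (EFin \o (fun x => M * `|g' x|)).
  apply: (@integrableS _ _ _ mu `[a, b]) => //; first exact: subset_itv_oc_cc.
  apply: continuous_segment_integrable => x.
  by apply: cvgM; [exact: cvg_cst|exact: cvg_norm (cg x)].
have mg' : measurable_fun `]a, b] g'.
  exact: continuous_measurable.
have f0M x : `|(f \_ A) x| <= M.
  by rewrite patchE; case: ifP => // _; rewrite normr0 (le_trans _ (fM 0)).
rewrite -Rintegral_itv_obnd_cbnd; last first.
  apply: le_integrable ig => //=.
    apply/measurable_EFinP; apply: measurable_funM => //.
    exact: measurable_funTS.
  move=> x _; rewrite lee_fin normrM [leRHS]ger0_norm ?ler_wpM2r//.
  by rewrite mulr_ge0// (le_trans _ (fM 0)).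
move=> e e0; apply: contrapT => noP.
have H n : exists P : nat * (nat -> R) * (nat -> R),
    [/\ tagged_partition a b P.1.1 P.1.2 P.2,
      (forall k, (k < P.1.1)%N -> P.1.2 k.+1 - P.1.2 k < n.+1%:R^-1)
    & e <= `|\sum_(k < P.1.1) g (P.2 k) * (f (P.1.2 k.+1) - f (P.1.2 k)) -
        (g b * f b - g a * f a - \int[mu]_(x in `]a, b]) ((f \_ A) x * g' x))|].
  apply: contrapT => nP; apply: noP; exists n.+1%:R^-1 => // p t tau tp td.
  by rewrite ltNge; apply/negP => ele; apply: nP; exists (p, t, tau).
have {H} [P HP] := choice H.
pose st n := tag_step f a b (P n).1.1 (P n).1.2 (P n).2.
have inv0 (e1 : R) : 0 < e1 -> \forall n \near \oo, n.+1%:R^-1 < e1 :> R.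
  by move=> e10; near=> n; near: n; exact: near_infty_natSinv_lt (PosNum e10).
have stP n x : `]a, b]%classic x -> exists2 y, `|y - x| <= n.+1%:R^-1 & st n x = f y.
  rewrite /= in_itv /= => xab; have [tp td _] := HP n.
  by apply: tag_stepP => //; rewrite invr_gt0.
have [|||||_ _ cv] := @Rdominated_convergence R `]a, b] (fun n x => st n x * g' x)
  (fun x => (f \_ A) x * g' x) (fun x => M * `|g' x|) _ _ _ _ ig.
- by [].
- by move=> n; apply: measurable_funM => //; exact: measurable_tag_step.
- by apply: measurable_funM => //; exact: measurable_funTS.
- have Ax : {ae mu, forall x, A x} by exact: nA.
  apply: lebesgue_ae_imply Ax => x Ax xab.
  apply: cvgM; last exact: cvg_cst.
  rewrite patchE mem_set//; apply/cvgrPdist_lt => /= e1 e10.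
  have /cvgrPdist_lt/(_ _ e10) := cf x Ax; move=> [d /= d0 hd].
  near=> n; have [y yx ->] := stP n x xab; apply: hd; rewrite /= distrC.
  by apply: (le_lt_trans yx); near: n; exact: inv0.
- apply: aeW => x n xab; rewrite normrM ler_wpM2r//.
  by have [y _ ->] := stP n x xab.
move: cv => /cvgrPdist_lt/(_ _ e0) [N _ /(_ N (leqnn N))] /=.
have [tp td] := HP N; rewrite (abel_RSsum _ _ tp) (integral_tag_step _ tp cg dg).
set X := \int[mu]_(x in _) _; set Y := \sum_(k < _) _ => h1 h2.
have : `|g b * f b - g a * f a - Y - (g b * f b - g a * f a - X)| = `|X - Y|.
  by congr `|_|; ring.
by move=> h3; move: h1; rewrite h3 => /le_lt_trans/(_ h2); rewrite ltxx.
Unshelve. all: by end_near. Qed.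

Lemma uniform_partition a b (d : R) : a <= b -> 0 < d ->
  exists N (t : nat -> R), [/\ t 0%N = a, t N = b,
    forall k, t k <= t k.+1 & forall k, t k.+1 - t k < d].
Proof.
move=> ab d0; pose N := (Num.truncn ((b - a) / d)).+1.
pose t (k : nat) := a + (b - a) * k%:R / N%:R.
have tS k : t k.+1 - t k = (b - a) / N%:R by rewrite /t -natr1; ring.
exists N, t; split.
- by rewrite /t mulr0 mul0r addr0.
- by rewrite /t mulfK ?pnatr_eq0// addrC subrK.
- by move=> k; rewrite -subr_ge0 tS divr_ge0// subr_ge0.
- move=> k; rewrite tS ltr_pdivrMr ?ltr0n// mulrC -ltr_pdivrMr//.
  have ba0 : 0 <= (b - a) / d by rewrite divr_ge0// ?subr_ge0// ltW.
  by have /andP[] := truncn_itv ba0.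
Qed.

Lemma is_RSint_unique f g a b (l1 l2 : R) : a <= b ->
  is_RSint g f a b l1 -> is_RSint g f a b l2 -> l1 = l2.
Proof.
move=> ab h1 h2; apply/eqP; rewrite -subr_eq0 -normr_eq0; apply/eqP/le_anti.
rewrite normr_ge0 andbT; apply/ler_addgt0Pl => e e0; rewrite addr0.
have e20 : 0 < e / 2 by rewrite divr_gt0.
have [d1 d10 {}h1] := h1 _ e20; have [d2 d20 {}h2] := h2 _ e20.
pose d := Num.min d1 d2; have d0 : 0 < d by rewrite lt_min d10.
have [N [t [t0 tN tS td]]] := uniform_partition ab d0.
have tp : tagged_partition a b N t t by split => // k _; rewrite lexx tS.
have := h1 N t t tp; have := h2 N t t tp.
set S := \sum_(k < N) _ => k2 k1.
have {}k1 : `|S - l1| < e / 2.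
  by apply: k1 => k _; apply: lt_le_trans (td k) _; rewrite ge_min lexx.
have {}k2 : `|S - l2| < e / 2.
  by apply: k2 => k _; apply: lt_le_trans (td k) _; rewrite ge_min lexx orbT.
have -> : l1 - l2 = (S - l2) - (S - l1) by ring.
rewrite (le_trans (ler_normB _ _))//; lra.
Qed.
End RiemannStieltjesByParts.

Section Kernels.
Context {R : realType}.
Notation mu := (@lebesgue_measure R).
Implicit Types (r x t theta : R).

Definition poisson_den r x := 1 - 2 * r * cos x + r ^+ 2.
Definition poisson r x := (1 - r ^+ 2) / poisson_den r x.
Definition conj_poisson_deriv r x :=
  (1 - r ^+ 2) ^+ 2 / poisson_den r x ^+ 2 - (1 + r ^+ 2) / poisson_den r x.

Lemma poisson_den_ge r x : 0 <= r -> (1 - r) ^+ 2 <= poisson_den r x.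
Proof.
move=> r0; rewrite /poisson_den; have := cos_le1 x; nra.
Qed.

Lemma poisson_den_gt0 r x : 0 <= r < 1 -> 0 < poisson_den r x.
Proof.
move=> /andP[r0 r1]; apply: lt_le_trans (poisson_den_ge x r0).
by rewrite exprn_gt0// subr_gt0.
Qed.

Lemma conj_poisson_periodic r : periodic (conj_poisson r) (2 * pi).
Proof.
by move=> x; rewrite /conj_poisson [2 * pi]mulr_natl sinD2pi cosD2pi.
Qed.

Lemma is_derive_conj_poisson r x : 0 <= r < 1 ->
  is_derive x 1 (conj_poisson r) (conj_poisson_deriv r x).
Proof.
move=> r01; have q0 := lt0r_neq0 (poisson_den_gt0 x r01).
have dn : is_derive x 1 (fun y => 2 * r * sin y) (2 * r * cos x).
  by have := is_deriveM (is_derive_cst (2 * r) x 1) (is_derive_sin x);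
     rewrite /GRing.scale /= mulr0 addr0.
have dq : is_derive x 1 (poisson_den r) (2 * r * sin x).
  have h : is_derive x 1 (fun y => 2 * r * cos y) (2 * r * - sin x).
    by have := is_deriveM (is_derive_cst (2 * r) x 1) (is_derive_cos x);
     rewrite /GRing.scale /= mulr0 addr0.
  have := is_deriveD (is_deriveB (is_derive_cst (1 : R) x 1) h)
    (is_derive_cst (r ^+ 2) x 1).
  by move/eq_is_derive; apply; [|ring].
have dv := is_deriveV q0 dq.
have := is_deriveM dn dv; move/eq_is_derive; apply => //.
rewrite /GRing.scale /= /conj_poisson_deriv; move: q0; rewrite /poisson_den => q0.
have sc : sin x ^+ 2 = 1 - cos x ^+ 2 by rewrite -(cos2Dsin2 x); ring.
field: sc; exact: q0.
Qed.

Lemma continuous_poisson_den r : continuous (poisson_den r).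
Proof.
move=> x; apply: cvgD; last exact: cvg_cst.
apply: cvgB; first exact: cvg_cst.
by apply: cvgM; [exact: cvg_cst|exact: continuous_cos].
Qed.

Lemma continuous_conj_poisson_deriv r : 0 <= r < 1 -> continuous (conj_poisson_deriv r).
Proof.
move=> r01 x; have q0 := lt0r_neq0 (poisson_den_gt0 x r01).
apply: cvgB; apply: cvgM; try exact: cvg_cst.
  apply: cvgV; first by rewrite expf_neq0.
  by rewrite !expr2; apply: cvgM; exact: continuous_poisson_den.
by apply: cvgV => //; exact: continuous_poisson_den.
Qed.

Lemma continuous_poisson r : 0 <= r < 1 -> continuous (poisson r).
Proof.
move=> r01 x; have q0 := lt0r_neq0 (poisson_den_gt0 x r01).
apply: cvgM; first exact: cvg_cst.
by apply: cvgV => //; exact: continuous_poisson_den.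
Qed.

Lemma continuous_reflect (f : R -> R) theta :
  continuous f -> continuous (fun t => f (theta - t)).
Proof.
move=> cf x; apply: continuous_comp; last exact: cf.
by apply: cvgB; [exact: cvg_cst|exact: cvg_id].
Qed.

Lemma is_RSint_conj_poisson (Phi : R -> R) (A : set R) (M : R) r theta :
  Phi pi = Phi (- pi) -> measurable_fun setT (Phi \_ A) ->
  mu.-negligible (~` A) -> (forall x, A x -> {for x, continuous Phi}) ->
  (forall x, `|Phi x| <= M) -> 0 <= r < 1 ->
  is_RSint (fun t => conj_poisson r (theta - t)) Phi (- pi) pi
    (\int[mu]_(t in `[- pi, pi])
       ((Phi \_ A) t * conj_poisson_deriv r (theta - t))).
Proof.
move=> pp mP nA cA PM r01.
have cK := continuous_reflect (theta := theta) (continuous_conj_poisson_deriv r01).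
have pi2 : - pi <= pi :> R by rewrite -subr_ge0 opprK addr_ge0// pi_ge0.
have dg x : is_derive x 1 (fun t => conj_poisson r (theta - t))
    (- conj_poisson_deriv r (theta - x)).
  have h : is_derive x 1 (fun t : R => theta - t) (- 1).
    have := is_deriveB (is_derive_cst theta x 1) (is_derive_id x 1).
    by move/eq_is_derive; apply => //; rewrite sub0r.
  have := @is_derive1_comp _ (conj_poisson r) (fun t => theta - t) x _ _
    (is_derive_conj_poisson (theta - x) r01) h.
  by move/eq_is_derive; apply => //; rewrite mulrN1.
have cK' : continuous (fun t => - conj_poisson_deriv r (theta - t)).
  by move=> x; apply: cvgN; exact: cK.
have := RSint_by_parts pi2 mP nA cA PM cK' dg.
have -> : conj_poisson r (theta - pi) = conj_poisson r (theta - - pi).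
  by rewrite -(conj_poisson_periodic r (theta - pi)); congr conj_poisson; ring.
rewrite pp subrr sub0r => h.
rewrite (_ : \int[mu]_(t in _) _ = - (\int[mu]_(x in `[- pi, pi])
  ((Phi \_ A) x * - conj_poisson_deriv r (theta - x)))); first exact: h.
have iK : mu.-integrable `[- pi, pi] (EFin \o (fun t =>
    (Phi \_ A) t * - conj_poisson_deriv r (theta - t))).
  apply: (@Rintegrable_bddM _ _ _ _ M) => //.
  - exact: measurable_funTS.
  - by move=> x _; rewrite patchE; case: ifP => // _; rewrite normr0 (le_trans _ (PM 0)).
  - exact: continuous_segment_integrable.
rewrite -[RHS]mulN1r -RintegralZl//; apply: eq_Rintegral => x _; ring.
Qed.

(* With [w = r e^(ix)], the right-hand side is [2 Re (w^(N+1) (1 - conj w))], that is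
   [|1 - w|^2] times the tail of [1 + 2 Re (sum w^n)]. *)
Lemma poisson_expansion r x N : 0 <= r < 1 ->
  poisson_den r x * (poisson r x -
     (1 + 2 * \sum_(n < N) r ^+ n.+1 * cos (n.+1%:R * x))) =
  2 * (r ^+ N.+1 * cos (N.+1%:R * x) - r ^+ 2 * (r ^+ N * cos (N%:R * x))).
Proof.
move=> r01; have q0 := lt0r_neq0 (poisson_den_gt0 x r01).
rewrite mulrBr /poisson [_ * (_ / _)]mulrC divfK//.
elim: N => [|N IHN].
  by rewrite big_ord0 /poisson_den mul0r cos0 mul1r; ring.
have rec : cos (N.+2%:R * x) = 2 * cos x * cos (N.+1%:R * x) - cos (N%:R * x).
  have -> : N.+2%:R * x = N.+1%:R * x + x by rewrite -[N.+2%:R]natr1; ring.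
  have -> : N%:R * x = N.+1%:R * x - x by rewrite -[N.+1%:R]natr1; ring.
  by rewrite cosD cosB; ring.
rewrite big_ord_recr /= rec !exprS; move: IHN; rewrite !exprS /poisson_den.
set C := cos (_ * x); set C0 := cos (_ * x) => IHN.
transitivity (2 * (r * r ^+ N * C - r * (r * r ^+ 0) * (r ^+ N * C0))
  - (1 - 2 * r * cos x + r * (r * r ^+ 0)) * (2 * (r * r ^+ N * C))).
  by rewrite -IHN; ring.
by ring.
Qed.

(* The tail of [2 Re (sum n w^n)] times [|1 - w|^4], namely
   [2 Re (w^(N+1) (N + 1 - N w) (1 - conj w)^2)], reduced to the powers [N] and [N + 1]. *)
Lemma conj_poisson_deriv_expansion r x N : 0 <= r < 1 ->
  let a := r ^+ N * cos (N%:R * x) in let b := r ^+ N.+1 * cos (N.+1%:R * x) in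
  let u := r * cos x in let p := r ^+ 2 in
  poisson_den r x ^+ 2 * (conj_poisson_deriv r x -
     2 * \sum_(n < N) n.+1%:R * r ^+ n.+1 * cos (n.+1%:R * x)) =
  2 * (N.+1%:R * b - N%:R * (2 * u * b - p * a) - 2 * N.+1%:R * p * a +
     2 * N%:R * p * b + N.+1%:R * p * (2 * u * a - b) - N%:R * p ^+ 2 * a).
Proof.
move=> r01 a b u p; have q0 := lt0r_neq0 (poisson_den_gt0 x r01).
rewrite mulrBr.
have -> : poisson_den r x ^+ 2 * conj_poisson_deriv r x =
    (1 - r ^+ 2) ^+ 2 - (1 + r ^+ 2) * poisson_den r x.
  by rewrite /conj_poisson_deriv; field.
rewrite /a /b {a b}; elim: N => [|N IHN].
  by rewrite big_ord0 /poisson_den /u /p !mul0r cos0 !mul1r; ring.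
have rec : cos (N.+2%:R * x) = 2 * cos x * cos (N.+1%:R * x) - cos (N%:R * x).
  have -> : N.+2%:R * x = N.+1%:R * x + x by rewrite -[N.+2%:R]natr1; ring.
  have -> : N%:R * x = N.+1%:R * x - x by rewrite -[N.+1%:R]natr1; ring.
  by rewrite cosD cosB; ring.
rewrite big_ord_recr /= rec.
set S := \sum_(i < N) _ in IHN *; set C := cos (N.+1%:R * x) in IHN *.
set C0 := cos (N%:R * x) in IHN *.
have -> : poisson_den r x ^+ 2 * (2 * (S + N.+1%:R * r ^+ N.+1 * C)) =
  poisson_den r x ^+ 2 * (2 * S) + 2 * poisson_den r x ^+ 2 * (N.+1%:R * r ^+ N.+1 * C).
  by ring.
rewrite opprD addrA IHN /poisson_den /u /p -[N.+2%:R]natr1 -[N.+1%:R]natr1 !exprS.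
ring.
Qed.

End Kernels.

Section TrigonometricPolynomials.
Context {R : realType}.
Notation mu := (@lebesgue_measure R).
Notation I := (`[- pi, pi]%classic : set R).
Implicit Types (k a b t r theta : R) (c d : nat -> R).

Definition trig k a b t := a * cos (k * t) + b * sin (k * t).

Definition trigsum c d N t := \sum_(n < N) trig n.+1%:R (c n) (d n) t.

Lemma oppi_le_pi : - pi <= pi :> R.
Proof. by rewrite -subr_ge0 opprK addr_ge0// pi_ge0. Qed.

Lemma is_derive_trig k a b t : is_derive t 1 (trig k a b) (trig k (k * b) (- (k * a)) t).
Proof.
have dk : is_derive t 1 (fun s : R => k * s) k.
  have := is_deriveM (is_derive_cst k t 1) (is_derive_id t (1 : R)).
  by move/eq_is_derive; apply => //; rewrite /GRing.scale /= mulr1 mulr0 addr0.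
have dc := @is_derive1_comp _ cos (fun s => k * s) t _ _ (is_derive_cos (k * t)) dk.
have ds := @is_derive1_comp _ sin (fun s => k * s) t _ _ (is_derive_sin (k * t)) dk.
have := is_deriveD (is_deriveM (is_derive_cst a t 1) dc)
                   (is_deriveM (is_derive_cst b t 1) ds).
move/eq_is_derive; apply => //; rewrite /GRing.scale /= /trig; ring.
Qed.

Lemma continuous_trig k a b : continuous (trig k a b).
Proof.
move=> t; apply/differentiable_continuous/derivable1_diffP.
by have := is_derive_trig k a b t.
Qed.

Lemma is_derive_trigsum c d N t : is_derive t 1 (trigsum c d N)
  (trigsum (fun n => n.+1%:R * d n) (fun n => - (n.+1%:R * c n)) N t).
Proof.
have := @is_derive_sum _ _ _ N (fun n : 'I_N => trig n.+1%:R (c n) (d n)) t 1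
  (fun n : 'I_N => trig n.+1%:R (n.+1%:R * d n) (- (n.+1%:R * c n)) t)
  (fun n => is_derive_trig _ _ _ _).
by move/eq_is_derive; apply => // y; rewrite fct_sumE.
Qed.

Lemma continuous_trigsum c d N : continuous (trigsum c d N).
Proof.
move=> t; apply/differentiable_continuous/derivable1_diffP.
by have := is_derive_trigsum c d N t.
Qed.

Lemma sin_natmul_pi n : sin (n%:R * pi) = 0 :> R.
Proof.
elim: n => [|n IHn]; first by rewrite mul0r sin0.
by rewrite -natr1 mulrDl mul1r sinDpi IHn oppr0.
Qed.

Lemma integral_trig_eq0 k a b : k != 0 -> sin (k * pi) = 0 ->
  \int[mu]_(t in I) trig k a b t = 0.
Proof.
move=> k0 sk.
have dF (x : R) : is_derive x 1 (trig k (- b / k) (a / k)) (trig k a b x).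
  have := is_derive_trig k (- b / k) (a / k) x.
  by move/eq_is_derive; apply => //; rewrite /trig; field.
rewrite (Rintegral_FTC2 oppi_le_pi (@continuous_trig k a b) dF).
by rewrite /trig mulrN sinN cosN sk; ring.
Qed.

Lemma trigM k l a b a' b' t : trig k a b t * trig l a' b' t =
  trig (k - l) ((a * a' + b * b') / 2) ((b * a' - a * b') / 2) t +
  trig (k + l) ((a * a' - b * b') / 2) ((a * b' + b * a') / 2) t.
Proof.
rewrite /trig.
have -> : (k - l) * t = k * t - l * t by ring.
have -> : (k + l) * t = k * t + l * t by ring.
by rewrite cosB sinB cosD sinD; field.
Qed.

Lemma integral_trigM m n a b a' b' :
  \int[mu]_(t in I) (trig m.+1%:R a b t * trig n.+1%:R a' b' t) =
  if m == n then pi * (a * a' + b * b') else 0.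
Proof.
under eq_Rintegral do rewrite trigM.
have ci k x y : mu.-integrable I (EFin \o trig k x y).
  by apply: continuous_segment_integrable; exact: continuous_trig.
rewrite RintegralD//.
rewrite [X in _ + X]integral_trig_eq0 ?addr0; last 2 first.
- by rewrite -natrD pnatr_eq0.
- by rewrite -natrD sin_natmul_pi.
case: eqVneq => [->|mn].
  rewrite subrr; under eq_Rintegral do rewrite /trig mul0r cos0 sin0 mulr1 mulr0 addr0.
  rewrite Rintegral_cst//= lebesgue_measure_itv /= lte_fin.
  by rewrite gtrN ?pi_gt0//= opprK; field.
apply: integral_trig_eq0.
  by rewrite subr_eq0 eqr_nat eqSS.
by rewrite mulrBl sinB !sin_natmul_pi mul0r mulr0 subrr.
Qed.

Lemma integral_trigsumM c d c' d' N M : (N <= M)%N ->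
  \int[mu]_(t in I) (trigsum c d N t * trigsum c' d' M t) =
  pi * \sum_(n < N) (c n * c' n + d n * d' n).
Proof.
move=> NM.
have ci (h : R -> R) : continuous h -> mu.-integrable I (EFin \o h).
  exact: continuous_segment_integrable.
pose h n m t := trig n.+1%:R (c n) (d n) t * trig m.+1%:R (c' m) (d' m) t.
have ch n m : continuous (h n m).
  by move=> t; apply: cvgM; exact: continuous_trig.
pose g n t := trig n.+1%:R (c n) (d n) t * trigsum c' d' M t.
have cg n : continuous (g n).
  by move=> t; apply: cvgM; [exact: continuous_trig|exact: continuous_trigsum].
transitivity (\int[mu]_(t in I) (\sum_(n < N) g n t)).
  by apply: eq_Rintegral => t _; rewrite -mulr_suml.
rewrite (Rintegral_sum _ (fun j _ => ci _ (cg j))).2// mulr_sumr.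
apply: eq_bigr => n _.
transitivity (\int[mu]_(t in I) (\sum_(m < M) h n m t)).
  by apply: eq_Rintegral => t _; rewrite -mulr_sumr.
rewrite (Rintegral_sum _ (fun j _ => ci _ (ch n j))).2//.
rewrite (bigD1 (widen_ord NM n)) //= big1 ?addr0.
  by rewrite integral_trigM eqxx.
by move=> m mn; rewrite integral_trigM ifN// eq_sym.
Qed.

Lemma integral_trigsum c d N : \int[mu]_(t in I) trigsum c d N t = 0.
Proof.
rewrite (Rintegral_sum (h := fun n => trig n.+1%:R (c n) (d n)) _ _).2//.
  rewrite big1// => n _; apply: integral_trig_eq0; first by rewrite pnatr_eq0.
  exact: sin_natmul_pi.
by move=> j _; apply: continuous_segment_integrable; exact: continuous_trig.
Qed.

Lemma natmul_exp_le (s : R) n : 0 <= s <= 1 ->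
  n.+1%:R * s ^+ n * (1 - s) <= 1 - s ^+ n.+1.
Proof.
move=> /andP[s0 s1]; elim: n => [|n IHn]; first by rewrite expr0 expr1; lra.
have sn : s ^+ n.+1 <= 1 by rewrite exprn_ile1.
rewrite -[n.+2%:R]natr1 [s ^+ n.+2]exprS.
have := ler_wpM2l s0 IHn.
have -> : s * (n.+1%:R * s ^+ n * (1 - s)) = n.+1%:R * s ^+ n.+1 * (1 - s).
  by rewrite exprS; ring.
move: sn; set X := s ^+ n.+1 => sn h.
rewrite mulrDl mulrDl mul1r; nra.
Qed.

Lemma cvg_natmul_exp r : 0 <= r < 1 -> (n.+1%:R * r ^+ n) @[n --> \oo] --> (0 : R).
Proof.
move=> /andP[r0 r1]; pose s := Num.sqrt r.
have s0 : 0 <= s by exact: sqrtr_ge0.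
have ss : s ^+ 2 = r by rewrite sqr_sqrtr.
have s1 : s < 1 by rewrite -(ltr_pXn2r (n := 2))// ?nnegrE// ss expr1n.
have h : (s ^+ n / (1 - s)) @[n --> \oo] --> (0 : R).
  rewrite -[X in _ --> X](mul0r (1 - s)^-1); apply: cvgM; last exact: cvg_cst.
  by apply: cvg_expr; rewrite ger0_norm.
apply: (squeeze_cvgr _ _ h); last exact: cvg_cst.
apply: nearW => n; rewrite mulr_ge0 ?exprn_ge0//= -ss exprAC expr2.
rewrite mulrA ler_pdivlMr ?subr_gt0// mulrAC ler_piMl ?exprn_ge0//.
apply: (le_trans (natmul_exp_le n _)); first by rewrite s0 ltW.
by rewrite gerBl exprn_ge0.
Qed.

Lemma cvg_integral_unif (psi f : R -> R) (f_ : (R -> R)^nat) (e : R^nat) :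
  continuous psi -> continuous f -> (forall n, continuous (f_ n)) ->
  (forall n t, `|f_ n t - f t| <= e n) -> e n @[n --> \oo] --> (0 : R) ->
  (\int[mu]_(t in I) (psi t * f_ n t)) @[n --> \oo] -->
  \int[mu]_(t in I) (psi t * f t).
Proof.
move=> cp cf cf_ fe e0.
have ci (h g : R -> R) : continuous h -> continuous g ->
    mu.-integrable I (EFin \o (fun t => h t * g t)).
  move=> ch cg; apply: continuous_segment_integrable => t.
  by apply: cvgM; [exact: ch|exact: cg].
have cn (h : R -> R) : continuous h -> continuous (fun t => `|h t|).
  by move=> ch t; apply: cvg_norm; exact: ch.
have cb n : continuous (fun t => f_ n t - f t).
  by move=> t; apply: cvgB; [exact: cf_|exact: cf].
have ipsi : mu.-integrable I (EFin \o (fun t => `|psi t|)).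
  by apply: continuous_segment_integrable; exact: cn.
have h0 : (e n * \int[mu]_(t in I) `|psi t|) @[n --> \oo] --> (0 : R).
  rewrite -[X in _ --> X](mul0r (\int[mu]_(t in I) `|psi t|)).
  by apply: cvgM => //; exact: cvg_cst.
apply/cvgrPdist_le => d d0; near=> n.
apply: (@le_trans _ _ (e n * \int[mu]_(t in I) `|psi t|)); last first.
  apply: (le_trans (ler_norm _)); near: n.
  by have /cvgrPdist_le/(_ _ d0) := h0; apply: filterS => n; rewrite sub0r normrN.
rewrite distrC -RintegralB//; try exact: ci.
have -> : \int[mu]_(t in I) (psi t * f_ n t - psi t * f t) =
    \int[mu]_(t in I) (psi t * (f_ n t - f t)).
  by apply: eq_Rintegral => t _; rewrite mulrBr.
rewrite (le_trans (le_normr_Rintegral _ _))//; first exact: ci.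
rewrite -RintegralZl//; apply: le_Rintegral => //.
- apply: continuous_segment_integrable; apply: cn => t.
  by apply: cvgM; [exact: cp|exact: cb].
- exact: RintegrableZl.
- by move=> t _; rewrite normrM mulrC ler_wpM2r.
Unshelve. all: by end_near. Qed.

End TrigonometricPolynomials.

Section PoissonMass.
Context {R : realType}.
Notation mu := (@lebesgue_measure R).
Notation I := (`[- pi, pi]%classic : set R).
Implicit Types (r t theta : R).

Definition poisson_cos r theta n := 2 * r ^+ n.+1 * cos (n.+1%:R * theta).
Definition poisson_sin r theta n := 2 * r ^+ n.+1 * sin (n.+1%:R * theta).

Lemma poisson_trigsum_le r theta K t : 0 <= r < 1 ->
  `|1 + trigsum (poisson_cos r theta) (poisson_sin r theta) K t -
    poisson r (theta - t)| <= 4 / (1 - r) ^+ 2 * (K.+1%:R * r ^+ K).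
Proof.
move=> r01; have /andP[r0 r1] := r01.
have rem N x : `|r ^+ N * cos x| <= r ^+ N.
  by rewrite normrM ger0_norm ?exprn_ge0// ler_piMr ?exprn_ge0// cos_max.
have d0 := poisson_den_gt0 (theta - t) r01.
have d1 := poisson_den_ge (theta - t) r0.
have := poisson_expansion (theta - t) K r01.
have -> : 1 + 2 * \sum_(n < K) r ^+ n.+1 * cos (n.+1%:R * (theta - t)) =
    (1 + trigsum (poisson_cos r theta) (poisson_sin r theta) K t).
  rewrite mulr_sumr; congr (_ + _); apply: eq_bigr => n _.
  by rewrite mulrBr cosB /trig /poisson_cos /poisson_sin; ring.
move: d0 d1; set D := poisson_den _ _ => d0 d1.
set x := r ^+ K * _; set y := r ^+ K.+1 * _ => e1.
rewrite distrC mulrAC ler_pdivlMr ?exprn_gt0 ?subr_gt0//.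
apply: (@le_trans _ _ (`|poisson r (theta - t) -
    (1 + trigsum (poisson_cos r theta) (poisson_sin r theta) K t)| * D)).
  by rewrite ler_wpM2l.
rewrite -[D]gtr0_norm// -normrM [_ * D]mulrC e1.
have xX : `|x| <= r ^+ K by exact: rem.
have yX : `|y| <= r ^+ K.
  by apply: (le_trans (rem _ _)); rewrite exprS ler_piMl ?exprn_ge0// ltW.
rewrite normrM ger0_norm//.
apply: (@le_trans _ _ (2 * (r ^+ K + 1 * r ^+ K))).
  rewrite ler_pM2l//; apply: (le_trans (ler_normB _ _)); apply: lerD => //.
  by rewrite normrM ler_pM// ger0_norm ?sqr_ge0// exprn_ile1// ltW.
have K1 : 1 <= K.+1%:R :> R by rewrite ler1n.
have X0 : 0 <= r ^+ K by rewrite exprn_ge0.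
move: K1 X0; move: (K.+1%:R : R) (r ^+ K) => k1 X; nra.
Qed.

Lemma integral_poisson r theta : 0 <= r < 1 ->
  \int[mu]_(t in I) poisson r (theta - t) = 2 * pi.
Proof.
move=> r01.
pose PM K t := 1 + trigsum (poisson_cos r theta) (poisson_sin r theta) K t.
have cPM K : continuous (PM K).
  by move=> t; apply: cvgD; [exact: cvg_cst|exact: continuous_trigsum].
have : (\int[mu]_(t in I) (1 * PM K t)) @[K --> \oo] -->
    \int[mu]_(t in I) (1 * poisson r (theta - t)).
  apply: (@cvg_integral_unif _ (fun=> 1) _ _
    (fun K => 4 / (1 - r) ^+ 2 * (K.+1%:R * r ^+ K))) => //.
  - by move=> t; exact: cvg_cst.
  - exact: continuous_reflect (continuous_poisson r01).
  - by move=> K t; exact: poisson_trigsum_le.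
  - rewrite -[X in _ --> X](mulr0 (4 / (1 - r) ^+ 2)).
    by apply: cvgM; [exact: cvg_cst|exact: cvg_natmul_exp].
under [X in _ --> X -> _]eq_Rintegral do rewrite mul1r.
move=> c1; rewrite -(cvg_unique _ c1 (_ : _ --> 2 * pi))//.
apply: cvg_near_cst; apply: nearW => K.
under eq_Rintegral do rewrite mul1r.
have i1 : mu.-integrable I (EFin \o (fun=> 1)).
  by apply: continuous_segment_integrable => x; exact: cvg_cst.
have i2 : mu.-integrable I (EFin \o trigsum (poisson_cos r theta) (poisson_sin r theta) K).
  by apply: continuous_segment_integrable; exact: continuous_trigsum.
rewrite RintegralD// integral_trigsum addr0 Rintegral_cst//= lebesgue_measure_itv /=.
by rewrite lte_fin gtrN ?pi_gt0//=; ring.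
Qed.

End PoissonMass.

Section LipschitzDuality.
Context {R : realType}.
Notation mu := (@lebesgue_measure R).
Notation I := (`[- pi, pi]%classic : set R).
Implicit Types (f g F G T : R -> R) (a b L r theta : R).

Lemma continuous_primitive f a b : a <= b -> continuous f ->
  exists2 F, (forall x : R, a <= x <= b -> is_derive x 1 F (f x)) &
    F b - F a = \int[mu]_(x in `[a, b]) f x.
Proof.
move=> ab cf; pose F x := \int[mu]_(t in `[a - 1, x]) f t.
have iF u v : mu.-integrable `[u, v] (EFin \o f) by exact: continuous_segment_integrable.
exists F.
  move=> x /andP[ax xb].
  have [||dF Ff] := @continuous_FTC1_closed _ f (a - 1) x (x + 1) _ (iF _ _) _ (cf x); try lra.
  by apply: DeriveDef => //; rewrite -derive1E.
rewrite /F Rintegral_itvB ?bnd_simp//; try lra.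
by rewrite Rintegral_itv_obnd_cbnd//; apply: integrableS (iF a b) => //; exact: subset_itv_oc_cc.
Qed.

Lemma lipschitz_continuous G L : (forall x y, `|G x - G y| <= L * `|x - y|) ->
  continuous G.
Proof.
move=> GL; have L0 : 0 <= L.
  by apply: le_trans (normr_ge0 (G 1 - G 0)) _; rewrite (le_trans (GL _ _))// subr0 normr1 mulr1.
have L1 : 0 < L + 1 by rewrite ltr_wpDl.
move=> x; apply/cvgrPdist_lt => e e0.
exists (e / (L + 1)); first by rewrite /= divr_gt0.
move=> y /= xy; apply: (le_lt_trans (GL x y)).
apply: (@le_lt_trans _ _ ((L + 1) * `|x - y|)); first by rewrite ler_wpM2r// lerDl.
by rewrite mulrC -ltr_pdivlMr.
Qed.

(* The tags are chosen by the mean value theorem for a primitive of [T ^+ 2], so that the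
   Riemann sums of [T ^+ 2] are exact; then [|T| L <= (T ^+ 2 + L ^+ 2) / 2]. *)
Lemma RSint_lipschitz_bound T T' G L (M : R) :
  (forall x y, `|G x - G y| <= L * `|x - y|) -> (forall x, `|G x| <= M) ->
  G pi = G (- pi) ->
  continuous T' -> (forall x : R, is_derive x 1 T (T' x)) -> T pi = T (- pi) ->
  `|\int[mu]_(t in I) (G t * T' t)| <=
    (\int[mu]_(t in I) (T t * T t)) / 2 + pi * L ^+ 2.
Proof.
move=> GL GM Gpi cT dT Tpi.
have pp := @oppi_le_pi R.
have cTT : continuous (fun t => T t * T t).
  have cT0 : continuous T.
    by move=> x; apply/differentiable_continuous/derivable1_diffP; have := dT x.
  by move=> x; apply: cvgM; exact: cT0.
have cG := lipschitz_continuous GL.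
have GT : G \_ setT = G by apply/funext => x; rewrite patchE in_setT.
have nT : mu.-negligible (~` [set: R]) by rewrite setCT; exact: negligible_set0.
have mG : measurable_fun setT (G \_ setT) by rewrite GT; exact: continuous_measurable.
have := RSint_by_parts pp mG nT (fun x _ => cG x) GM cT dT.
rewrite GT Tpi Gpi subrr sub0r => hRS.
apply/ler_addgt0Pl => e e0; have [d d0 {}hRS] := hRS _ e0.
have [N [t [t0 tN tS td]]] := uniform_partition pp d0.
have [F dF FI] := continuous_primitive pp cTT.
have tpi k : (k <= N)%N -> - pi <= t k <= pi.
  have th : {homo t : i j / (i <= j)%N >-> i <= j}.
    by apply: homo_leq => [x|x y z|k']; [exact: lexx|exact: le_trans|exact: tS].
  by move=> kN; rewrite -{1}t0 -tN !th.
have mv k : exists c, (k < N)%N -> t k <= c <= t k.+1 /\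
    F (t k.+1) - F (t k) = T c * T c * (t k.+1 - t k).
  have [kN|] := ltnP k N; last by move=> _; exists 0.
  have /andP[l1 l2] := tpi k (ltnW kN); have /andP[l3 l4] := tpi k.+1 kN.
  have dF' x : x \in `](t k), (t k.+1)[%R -> is_derive x 1 F (T x * T x).
    by rewrite in_itv /= => /andP[x1 x2]; apply: dF; apply/andP; split; lra.
  have [|c] := MVT_segment (tS k) dF'.
    apply: continuous_in_subspaceT => x /set_mem /=; rewrite in_itv /= => /andP[x1 x2].
    apply/differentiable_continuous/derivable1_diffP.
    by have : is_derive x 1 F (T x * T x) by apply: dF; apply/andP; split; lra.
  by rewrite in_itv /= => cin FE; exists c.
have [tau htau] := choice mv.
have tp : tagged_partition (- pi) pi N t tau.
  by split => // k kN; have [] := htau k kN.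
have := hRS N t tau tp (fun k _ => td k).
set l := \int[mu]_(x in _) _; set S := \sum_(k < N) _ => hS.
have SB : `|S| <= (\int[mu]_(t in I) (T t * T t)) / 2 + pi * L ^+ 2.
  apply: (@le_trans _ _ (\sum_(k < N) ((F (t k.+1) - F (t k)) / 2 +
      L ^+ 2 / 2 * (t k.+1 - t k)))).
    apply: (le_trans (ler_norm_sum _ _ _)); apply: ler_sum => k _.
    have [_ ->] := htau k (ltn_ord k); rewrite normrM.
    have := GL (t k.+1) (t k); rewrite [`|t k.+1 - _|]ger0_norm ?subr_ge0//.
    have : 0 <= t k.+1 - t k by rewrite subr_ge0.
    move: (t k.+1 - t k) => D D0 gD.
    have : 0 <= `|T (tau k)| by [].
    have -> : T (tau k) * T (tau k) = `|T (tau k)| * `|T (tau k)|.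
      by rewrite -normrM ger0_norm// -expr2 sqr_ge0.
    move: (`|T (tau k)|) => X X0.
    apply: (@le_trans _ _ (X * (L * D))); first by rewrite ler_wpM2l.
    have := mulr_ge0 D0 (sqr_ge0 (X - L)); nra.
  rewrite big_split /= -mulr_suml -mulr_sumr.
  have tel (h : nat -> R) : \sum_(k < N) (h k.+1 - h k) = h N - h 0%N.
    by rewrite -(big_mkord xpredT (fun k => h k.+1 - h k)) telescope_sumr.
  rewrite (tel (F \o t)) (tel t) /= t0 tN FI.
  by rewrite lerD2l; lra.
have : `|l| <= `|S| + `|S - - l|.
  by have := ler_normB S (S - - l); rewrite (_ : S - (S - - l) = - l) ?normrN//; ring.
lra.
Qed.

End LipschitzDuality.

Section L1Limit.
Context {R : realType}.
Notation mu := (@lebesgue_measure R).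
Implicit Types (D : set R).

Lemma summable_L1_limit D (F : (R -> R)^nat) (c : R^nat) (C : R) : measurable D ->
  (forall n, mu.-integrable D (EFin \o F n)) ->
  (forall n, \int[mu]_(x in D) `|F n.+1 x - F n x| <= c n) ->
  (forall n, \sum_(k < n) c k <= C) ->
  exists2 v : R -> R, measurable_fun D v & exists g : R -> R,
    [/\ mu.-integrable D (EFin \o g),
        {ae mu, forall x, D x -> F n x @[n --> \oo] --> v x} &
        {ae mu, forall x n, D x -> `|F n x| <= g x}].
Proof.
move=> mD iF Fc cC.
have mF n : measurable_fun D (F n) by apply/measurable_EFinP; exact: measurable_int (iF n).
pose d n (x : R) : R := `|F n.+1 x - F n x|.
have d0 n x : 0 <= d n x by exact: normr_ge0.
have md n : measurable_fun D (d n).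
  by apply: measurableT_comp => //; exact: measurable_funB.
have mEd n : measurable_fun D (fun x => (d n x)%:E) by exact/measurable_EFinP.
have idn n : mu.-integrable D (EFin \o d n).
  exact: (integrable_norm (RintegrableB mD (iF n.+1) (iF n))).
pose h x := (\sum_(n <oo) (d n x)%:E)%E.
have mh : measurable_fun D h.
  apply: (@ge0_emeasurable_sum _ _ _ D (fun n x => (d n x)%:E) xpredT) => [n x Dx _|n _].
    by rewrite lee_fin d0.
  exact/measurable_EFinP.
have h0 x : (0 <= h x)%E by apply: nneseries_ge0 => n _ _; rewrite lee_fin d0.
have ih : mu.-integrable D h.
  apply/integrableP; split => //.
  under eq_integral do rewrite gee0_abs//.
  rewrite /h integral_nneseries//; last by move=> n x Dx; rewrite lee_fin d0.
  apply: (@le_lt_trans _ _ C%:E); last exact: ltry.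
  apply: lime_le.
    by apply: is_cvg_nneseries => n _ _; apply: integral_ge0 => x Dx; rewrite lee_fin d0.
  apply: nearW => n; rewrite /= big_mkord.
  apply: (@le_trans _ _ (\sum_(k < n) (c k)%:E)%E); last by rewrite sumEFin lee_fin.
  apply: lee_sum => k _; rewrite -[leLHS]fineK; last first.
    by apply: integrable_fin_num => //; exact: (idn k).
  by rewrite lee_fin; exact: Fc.
have fh := @integrable_ae _ _ _ mu D mD _ ih.
pose g x := `|F 0%N x| + fine (h x).
have dh x n : h x \is a fin_num -> \sum_(k < n) d k x <= fine (h x).
  move=> hx; rewrite -lee_fin fineK// -sumEFin -(big_mkord xpredT (fun k => (d k x)%:E)).
  by apply: nneseries_lim_ge => k _ _; rewrite lee_fin d0.
have Fsum n x : F n x = F 0%N x + \sum_(k < n) (F k.+1 x - F k x).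
  rewrite -(big_mkord xpredT (fun k => F k.+1 x - F k x)) telescope_sumr//.
  by rewrite addrC subrK.
pose v x := fine (limn_esup (fun n => (F n x)%:E)).
exists v.
  apply: measurableT_comp => //.
  by apply: measurable_fun_limn_esup => n; exact/measurable_EFinP.
exists g; split.
- apply: RintegrableD => //; first exact: (integrable_norm (iF 0%N)).
  apply: (@le_integrable _ _ _ mu D mD _ _ _ _ ih).
    by apply/measurable_EFinP; apply: measurableT_comp.
  move=> x Dx /=; rewrite [leRHS]gee0_abs// ger0_norm ?fine_ge0//.
  by case: (h x) (h0 x) => //= r _; rewrite leey.
- apply: lebesgue_ae_imply fh => x + Dx => /(_ Dx) hx.
  have cF : cvgn (fun n => F n x).
    have : cvgn (series (fun k => F k.+1 x - F k x)).
      apply: normed_cvg; apply: nondecreasing_is_cvgn.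
        by apply: nondecreasing_series => n _ _; exact: normr_ge0.
      exists (fine (h x)) => _ [n _ <-]; apply: le_trans (dh x n hx).
      by rewrite -(big_mkord xpredT (fun k => d k x)).
    move=> cs; have : cvgn (fun n => F 0%N x + series (fun k => F k.+1 x - F k x) n).
      by apply: is_cvgD => //; exact: is_cvg_cst.
    by congr (cvgn _); apply/funext => n; rewrite /series /= big_mkord -Fsum.
  have cE : (F n x)%:E @[n --> \oo] --> (limn (fun n => F n x))%:E.
    by apply: cvg_EFin; [exact: nearW|exact: cF].
  rewrite /v is_cvg_limn_esupE; last by apply/cvg_ex; eexists; exact: cE.
  by rewrite (cvg_lim _ cE)//; exact: cF.
- apply: lebesgue_ae_imply fh => x + n Dx => /(_ Dx) hx.
  rewrite Fsum (le_trans (ler_normD _ _))// lerD2l.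
  by apply: le_trans (dh x n hx); exact: ler_norm_sum.
Qed.

End L1Limit.

Section LipschitzFourier.
Context {R : realType}.
Notation mu := (@lebesgue_measure R).
Notation I := (`[- pi, pi]%classic : set R).
Variables (G : R -> R) (L M : R).
Hypothesis GL : forall x y, `|G x - G y| <= L * `|x - y|.
Hypothesis GM : forall x, `|G x| <= M.
Hypothesis Gpi : G pi = G (- pi).

Definition fourier_cos n : R := pi^-1 * \int[mu]_(t in I) (G t * cos (n.+1%:R * t)).
Definition fourier_sin n : R := pi^-1 * \int[mu]_(t in I) (G t * sin (n.+1%:R * t)).

(* Formal derivative of the conjugate Fourier series of [G]. *)
Definition conj_deriv_sum N : R -> R :=
  trigsum (fun n => n.+1%:R * fourier_cos n) (fun n => n.+1%:R * fourier_sin n) N.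

Let cG : continuous G := lipschitz_continuous GL.

Lemma integral_mul_trigsum c d N :
  \int[mu]_(t in I) (G t * trigsum c d N t) =
  pi * \sum_(n < N) (c n * fourier_cos n + d n * fourier_sin n).
Proof.
have ci h : continuous h -> mu.-integrable I (EFin \o (fun t => G t * h t)).
  move=> ch; apply: continuous_segment_integrable => t.
  by apply: cvgM; [exact: cG|exact: ch].
have ct n : continuous (trig n.+1%:R (c n) (d n)) by exact: continuous_trig.
transitivity (\int[mu]_(t in I) (\sum_(n < N) G t * trig n.+1%:R (c n) (d n) t)).
  by apply: eq_Rintegral => t _; rewrite mulr_sumr.
rewrite (Rintegral_sum _ (fun n _ => ci _ (ct n))).2// mulr_sumr; apply: eq_bigr => n _.
have e a b : trig n.+1%:R a b = fun t => a * cos (n.+1%:R * t) + b * sin (n.+1%:R * t) by [].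
have cc : continuous (fun t : R => cos (n.+1%:R * t)).
  move=> t; have := @continuous_trig _ n.+1%:R 1 0 t; rewrite e.
  by congr (continuous_at _ _); apply/funext => x; rewrite mul1r mul0r addr0.
have cs : continuous (fun t : R => sin (n.+1%:R * t)).
  move=> t; have := @continuous_trig _ n.+1%:R 0 1 t; rewrite e.
  by congr (continuous_at _ _); apply/funext => x; rewrite mul1r mul0r add0r.
transitivity (\int[mu]_(t in I) (c n * (G t * cos (n.+1%:R * t)) +
    d n * (G t * sin (n.+1%:R * t)))).
  by apply: eq_Rintegral => t _; rewrite /trig; ring.
rewrite RintegralD//; try by apply: RintegrableZl => //; exact: ci.
rewrite !RintegralZl//; try exact: ci.
have p0 : pi != 0 :> R by exact/lt0r_neq0/pi_gt0.
have pK (x : R) : pi * (pi^-1 * x) = x by rewrite mulrA divff// mul1r.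
by rewrite /fourier_cos /fourier_sin mulrDr (mulrCA pi (c n)) (mulrCA pi (d n)) !pK.
Qed.

Let s N := \sum_(n < N) n.+1%:R ^+ 2 * (fourier_cos n ^+ 2 + fourier_sin n ^+ 2).

(* Testing [G] against the derivative of [T], both [\int G T'] and [\int T ^+ 2]
   equal [pi * s N]. *)
Lemma fourier_sum_le N : s N <= 2 * L ^+ 2.
Proof.
pose T := trigsum (fun n => - (n.+1%:R * fourier_sin n)) (fun n => n.+1%:R * fourier_cos n) N.
pose T' := trigsum (fun n => n.+1%:R * (n.+1%:R * fourier_cos n))
  (fun n => - (n.+1%:R * - (n.+1%:R * fourier_sin n))) N.
have dT (x : R) : is_derive x 1 T (T' x) by exact: is_derive_trigsum.
have cT' : continuous T' by exact: continuous_trigsum.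
have Tpi : T pi = T (- pi).
  apply: eq_bigr => n _; rewrite /trig mulrN cosN sinN sin_natmul_pi; ring.
have := RSint_lipschitz_bound GL GM Gpi cT' dT Tpi.
rewrite integral_mul_trigsum integral_trigsumM//.
set X := pi * _; set Y := pi * _ => h.
have XE : X = pi * s N.
  by rewrite /X; congr (_ * _); apply: eq_bigr => n _; ring.
have YE : Y = pi * s N.
  by rewrite /Y; congr (_ * _); apply: eq_bigr => n _; ring.
move: h; rewrite XE YE => /(le_trans (ler_norm _)) h.
have p0 := @pi_gt0 R; rewrite -(ler_pM2l p0); lra.
Qed.

Let s_homo : {homo s : m n / (m <= n)%N >-> m <= n}.
Proof.
apply: homo_leq => [x|x y z|k]; [exact: lexx|exact: le_trans|].
by rewrite /s big_ord_recr /= lerDl mulr_ge0 ?addr_ge0 ?sqr_ge0.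
Qed.

Lemma conj_deriv_sum_dist N K : (N <= K)%N ->
  \int[mu]_(t in I) (conj_deriv_sum K t - conj_deriv_sum N t) ^+ 2 =
  pi * (s K - s N).
Proof.
move=> NK.
have ci a b P Q : mu.-integrable I (EFin \o (fun t => trigsum a b P t * trigsum a b Q t)).
  apply: continuous_segment_integrable => t.
  by apply: cvgM; exact: continuous_trigsum.
rewrite /conj_deriv_sum; set a := fun n => _ * fourier_cos n; set b := fun n => _ * fourier_sin n.
transitivity (\int[mu]_(t in I) (trigsum a b K t * trigsum a b K t +
  (trigsum a b N t * trigsum a b N t - 2 * (trigsum a b N t * trigsum a b K t)))).
  by apply: eq_Rintegral => t _; ring.
rewrite RintegralD//; last by apply: RintegrableB => //; exact: RintegrableZl.
rewrite RintegralB//; last exact: RintegrableZl.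
rewrite RintegralZl// !integral_trigsumM//.
have e P : \sum_(n < P) (a n * a n + b n * b n) = s P.
  by apply: eq_bigr => n _; rewrite /a /b; ring.
by rewrite !e; ring.
Qed.

Lemma conj_deriv_sum_limit : exists (v : R -> R) (Nk : nat -> nat),
  [/\ {homo Nk : m n / (m <= n)%N >-> (m <= n)%N}, (forall k, (k <= Nk k)%N),
    mu.-integrable I (EFin \o v) &
    forall psi : R -> R, continuous psi ->
      (\int[mu]_(t in I) (psi t * conj_deriv_sum (Nk k) t)) @[k --> \oo] -->
      \int[mu]_(t in I) (psi t * v t)].
Proof.
pose q : R := 2^-1; have q0 k : 0 < q ^+ k by rewrite exprn_gt0// invr_gt0.
have cs : cvgn s.
  apply: nondecreasing_is_cvgn => [m n|]; first exact: s_homo.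
  by exists (2 * L ^+ 2) => _ [n _ <-]; exact: fourier_sum_le.
have sle n : s n <= limn s by apply: nondecreasing_cvgn_le => //; exact: s_homo.
have hn k : exists n0, forall n, (n0 <= n)%N -> limn s - s n <= q ^+ k * q ^+ k.
  have /cvgrPdist_le/(_ _ (mulr_gt0 (q0 k) (q0 k))) [n0 _ h0] := cs.
  by exists n0 => n n0n; apply: (le_trans (ler_norm _)); exact: h0.
have {hn} [n0 hn0] := choice hn.
pose Nk k := (k + \sum_(j < k.+1) n0 j)%N.
have Nn0 k : (n0 k <= Nk k)%N.
  by rewrite /Nk big_ord_recr /= addnA leq_addl.
have NkS : {homo Nk : m n / (m <= n)%N >-> (m <= n)%N}.
  apply: homo_leq => [x|x y z|k]; [exact: leqnn|exact: leq_trans|].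
  have -> : Nk k.+1 = (Nk k + n0 k.+1).+1.
    by rewrite /Nk [in LHS]big_ord_recr /= addSn addnA.
  by rewrite leqW// leq_addr.
have cF k : continuous (conj_deriv_sum (Nk k)) by exact: continuous_trigsum.
have iF k : mu.-integrable I (EFin \o conj_deriv_sum (Nk k)).
  exact: continuous_segment_integrable.
pose c k := 3 / 2 * pi * q ^+ k.
have Fc k : \int[mu]_(x in I) `|conj_deriv_sum (Nk k.+1) x - conj_deriv_sum (Nk k) x| <= c k.
  pose D x := conj_deriv_sum (Nk k.+1) x - conj_deriv_sum (Nk k) x.
  have cD : continuous D by move=> x; apply: cvgB; exact: cF.
  have cD2 : continuous (fun x => D x ^+ 2).
    by move=> x; exact: (cvgM (cD x) (cD x)).
  have iD : mu.-integrable I (EFin \o D) by exact: continuous_segment_integrable.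
  have iD2 : mu.-integrable I (EFin \o (fun x => D x ^+ 2)).
    exact: continuous_segment_integrable.
  have iq : mu.-integrable I (EFin \o (fun=> q ^+ k / 2)).
    by apply: continuous_segment_integrable => x; exact: cvg_cst.
  apply: (@le_trans _ _ (\int[mu]_(x in I) ((2 * q ^+ k)^-1 * D x ^+ 2 + q ^+ k / 2))).
    apply: le_Rintegral => //; first exact: (integrable_norm iD).
      by apply: RintegrableD => //; exact: RintegrableZl.
    move=> x _; rewrite -/(D x) -(real_normK (num_real (D x))).
    rewrite -(ler_pM2l (q0 k)) mulrDr -subr_ge0.
    have qk := lt0r_neq0 (q0 k).
    have -> : q ^+ k * ((2 * q ^+ k)^-1 * `|D x| ^+ 2) + q ^+ k * (q ^+ k / 2) -
      q ^+ k * `|D x| = (`|D x| - q ^+ k) ^+ 2 / 2 by field.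
    by rewrite divr_ge0// sqr_ge0.
  rewrite RintegralD//; last exact: RintegrableZl.
  have hD : \int[mu]_(x in I) (D x ^+ 2) = pi * (s (Nk k.+1) - s (Nk k)).
    exact: conj_deriv_sum_dist (NkS _ _ (leqnSn k)).
  rewrite [X in X + _]RintegralZl// hD.
  rewrite Rintegral_cst//= lebesgue_measure_itv /= lte_fin gtrN ?pi_gt0//=.
  have h1 : s (Nk k.+1) - s (Nk k) <= q ^+ k * q ^+ k.
    by apply: le_trans (hn0 k (Nk k) (Nn0 k)); rewrite lerD2r.
  have h2 : (2 * q ^+ k)^-1 * (pi * (s (Nk k.+1) - s (Nk k))) <= pi * q ^+ k / 2.
    rewrite ler_pdivrMl ?mulr_gt0//.
    have -> : 2 * q ^+ k * (pi * q ^+ k / 2) = pi * (q ^+ k * q ^+ k) by field.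
    by rewrite ler_pM2l// pi_gt0.
  by apply: (le_trans (lerD h2 (lexx _))); rewrite /c; lra.
have cC n : \sum_(k < n) c k <= 3 * pi.
  have -> : \sum_(k < n) c k = 3 * pi * (1 - q ^+ n).
    elim: n => [|n IHn]; first by rewrite big_ord0 expr0 subrr mulr0.
    by rewrite big_ord_recr /= IHn /c exprS /q; field.
  by rewrite ler_piMr ?mulr_ge0 ?pi_ge0// gerBl ltW.
have [//|v mv [g [ig Fv Fg]]] := summable_L1_limit _ iF Fc cC.
exists v, Nk; split => //.
- by move=> k; exact: leq_addr.
- by have [] := Rdominated_convergence _ (fun k => continuous_measurable (cF k)) mv Fv ig Fg.
move=> psi cpsi.
have [B psiB] : exists B : R, forall x, I x -> `|psi x| <= B.
  have cn : {within I, continuous (fun x => `|psi x|)}.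
    by apply: continuous_subspaceT => x; apply: cvg_norm; exact: cpsi.
  by have [x0 _ hx0] := EVT_max (@oppi_le_pi R) cn; exists `|psi x0| => x /hx0.
have mpsi (h : R -> R) : measurable_fun I h -> measurable_fun I (fun t => psi t * h t).
  by move=> mh; apply: measurable_funM => //; exact: continuous_measurable.
have ig' : mu.-integrable I (EFin \o (fun x => B * g x)) by exact: RintegrableZl.
have [|||||_ _] := @Rdominated_convergence R I (fun k t => psi t * conj_deriv_sum (Nk k) t)
  (fun t => psi t * v t) _ _ _ _ _ ig' => //.
- by move=> k; apply: mpsi; exact: continuous_measurable.
- exact: mpsi.
- by apply: lebesgue_ae_imply Fv => x + Ix => /(_ Ix); apply: cvgM; exact: cvg_cst.
- apply: lebesgue_ae_imply Fg => x + n Ix => /(_ n Ix) h.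
  by rewrite normrM ler_pM// psiB.
Qed.

Lemma integral_lipschitz_conj_poisson_deriv : exists2 v : R -> R,
  mu.-integrable I (EFin \o v) &
  forall r theta, 0 <= r < 1 ->
    \int[mu]_(t in I) (G t * conj_poisson_deriv r (theta - t)) =
    \int[mu]_(t in I) (v t * poisson r (theta - t)).
Proof.
have [v [Nk [NkS Nkk iv cv]]] := conj_deriv_sum_limit.
exists v => // r theta r01; have /andP[r0 r1] := r01.
pose a n := n.+1%:R * fourier_cos n; pose b n := n.+1%:R * fourier_sin n.
pose u N := 2 * pi * \sum_(n < N) r ^+ n.+1 * trig n.+1%:R (a n) (b n) theta.
have cosE n t : cos (n.+1%:R * (theta - t)) =
    trig n.+1%:R (cos (n.+1%:R * theta)) (sin (n.+1%:R * theta)) t.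
  by rewrite /trig mulrBr cosB.
have rem N x : `|r ^+ N * cos x| <= r ^+ N.
  by rewrite normrM ger0_norm ?exprn_ge0// ler_piMr ?exprn_ge0// cos_max.
have den x : 0 < poisson_den r x /\ (1 - r) ^+ 2 <= poisson_den r x.
  by split; [exact: poisson_den_gt0|exact: poisson_den_ge].
have u1 : u N @[N --> \oo] -->
    \int[mu]_(t in I) (G t * conj_poisson_deriv r (theta - t)).
  pose A n := 2 * n.+1%:R * r ^+ n.+1 * cos (n.+1%:R * theta).
  pose B n := 2 * n.+1%:R * r ^+ n.+1 * sin (n.+1%:R * theta).
  have uE N : u N = \int[mu]_(t in I) (G t * trigsum A B N t).
    rewrite integral_mul_trigsum /u -mulrA mulrCA; congr (_ * _).
    by rewrite mulr_sumr; apply: eq_bigr => n _; rewrite /trig /A /B /a /b; ring.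
  under eq_fun do rewrite uE.
  apply: (@cvg_integral_unif _ G _ _ (fun N => 24 / (1 - r) ^+ 4 * (N.+1%:R * r ^+ N))) => //.
  - exact: continuous_reflect (continuous_conj_poisson_deriv r01).
  - by move=> N; exact: continuous_trigsum.
  - move=> N t; have [d0 d1] := den (theta - t).
    have := conj_poisson_deriv_expansion (theta - t) N r01.
    have -> : 2 * \sum_(n < N) n.+1%:R * r ^+ n.+1 * cos (n.+1%:R * (theta - t)) =
        trigsum A B N t.
      rewrite mulr_sumr; apply: eq_bigr => n _.
      by rewrite cosE /trig /A /B; ring.
    move: d0 d1; rewrite /=; set D := poisson_den _ _ => d0 d1.
    set x := r ^+ N * _; set y := r ^+ N.+1 * _; set w := r * cos _ => e1.
    rewrite distrC mulrAC ler_pdivlMr ?exprn_gt0 ?subr_gt0//.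
    have d2 : (1 - r) ^+ 4 <= D ^+ 2.
      by rewrite (exprM _ 2 2) ler_pXn2r// nnegrE ?sqr_ge0// ltW.
    apply: (@le_trans _ _ (`|conj_poisson_deriv r (theta - t) - trigsum A B N t| * D ^+ 2)).
      by rewrite ler_wpM2l.
    rewrite -[D ^+ 2]ger0_norm ?sqr_ge0// -normrM [_ * D ^+ 2]mulrC e1.
    have xX : `|x| <= r ^+ N by exact: rem.
    have yX : `|y| <= r ^+ N.
      by apply: (le_trans (rem _ _)); rewrite exprS ler_piMl ?exprn_ge0// ltW.
    have wb : -1 <= w <= 1.
      rewrite -ler_norml; have := rem 1 (theta - t).
      by rewrite !expr1 => /le_trans; apply; exact: ltW.
    have p01 : 0 <= r ^+ 2 <= 1 by rewrite sqr_ge0 exprn_ile1// ltW.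
    have N0 : 0 <= N%:R :> R by [].
    move: xX yX wb p01 N0; have -> : N.+1%:R = N%:R + 1 :> R by rewrite natr1.
    move: (r ^+ N) (N%:R) (r ^+ 2) => X K p.
    move=> xX yX /andP[w1 w2] /andP[p1 p2] K0.
    have -> : 2 * ((K + 1) * y - K * (2 * w * y - p * x) - 2 * (K + 1) * p * x +
      2 * K * p * y + (K + 1) * p * (2 * w * x - y) - K * p ^+ 2 * x) =
      2 * ((K + 1 - 2 * (K * w) + 2 * (K * p) - (K + 1) * p) * y +
        (K * p - 2 * ((K + 1) * p) + 2 * ((K + 1) * p * w) - K * p * p) * x) by ring.
    have Kw1 : - (K + 1) <= K * w by nra.
    have Kw2 : K * w <= K + 1 by nra.
    have Kp1 : 0 <= K * p by rewrite mulr_ge0.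
    have Kp2 : K * p <= K + 1 by nra.
    have Lp1 : 0 <= (K + 1) * p by rewrite mulr_ge0// addr_ge0.
    have Lp2 : (K + 1) * p <= K + 1 by rewrite ler_piMr// addr_ge0.
    have Lw1 : - (K + 1) <= (K + 1) * p * w by nra.
    have Lw2 : (K + 1) * p * w <= K + 1 by nra.
    have Kpp1 : 0 <= K * p * p by rewrite mulr_ge0.
    have Kpp2 : K * p * p <= K + 1 by nra.
    rewrite normrM ger0_norm//.
    apply: (@le_trans _ _ (2 * ((6 * (K + 1)) * X + (6 * (K + 1)) * X))); last by lra.
    rewrite ler_pM2l//; apply: (le_trans (ler_normD _ _)); apply: lerD; rewrite normrM ler_pM//.
      by rewrite ler_norml; apply/andP; split; lra.
    by rewrite ler_norml; apply/andP; split; lra.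
  - rewrite -[X in _ --> X](mulr0 (24 / (1 - r) ^+ 4)).
    by apply: cvgM; [exact: cvg_cst|exact: cvg_natmul_exp].
have SP N : \int[mu]_(t in I) (poisson r (theta - t) * conj_deriv_sum N t) = u N.
  pose A := poisson_cos r theta; pose B := poisson_sin r theta.
  pose PM K t := 1 + trigsum A B K t.
  have cPM K : continuous (PM K).
    by move=> t; apply: cvgD; [exact: cvg_cst|exact: continuous_trigsum].
  have cS : continuous (conj_deriv_sum N) by exact: continuous_trigsum.
  have c1 : (\int[mu]_(t in I) (conj_deriv_sum N t * PM K t)) @[K --> \oo] -->
      \int[mu]_(t in I) (conj_deriv_sum N t * poisson r (theta - t)).
    apply: (@cvg_integral_unif _ _ _ _ (fun K => 4 / (1 - r) ^+ 2 * (K.+1%:R * r ^+ K))) => //.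
    - exact: continuous_reflect (continuous_poisson r01).
    - by move=> K t; exact: poisson_trigsum_le.
    - rewrite -[X in _ --> X](mulr0 (4 / (1 - r) ^+ 2)).
      by apply: cvgM; [exact: cvg_cst|exact: cvg_natmul_exp].
  have c2 : (\int[mu]_(t in I) (conj_deriv_sum N t * PM K t)) @[K --> \oo] --> u N.
    apply: cvg_near_cst; exists N => // K /= NK.
    have ic (h : R -> R) : continuous h -> mu.-integrable I (EFin \o h).
      exact: continuous_segment_integrable.
    transitivity (\int[mu]_(t in I) (conj_deriv_sum N t +
        conj_deriv_sum N t * trigsum A B K t)).
      by apply: eq_Rintegral => t _; rewrite /PM; ring.
    rewrite RintegralD//; [|exact: ic|]; last first.
      by apply: ic => t; apply: cvgM; exact: continuous_trigsum.
    rewrite integral_trigsum integral_trigsumM// add0r /u -mulrA mulrCA; congr (_ * _).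
    rewrite mulr_sumr; apply: eq_bigr => n _;
    by rewrite /trig /A /B /poisson_cos /poisson_sin /a /b; ring.
  rewrite -(cvg_unique _ c1 c2)//.
  by apply: eq_Rintegral => t _; rewrite mulrC.
have u2 : u (Nk k) @[k --> \oo] --> \int[mu]_(t in I) (poisson r (theta - t) * v t).
  under eq_fun do rewrite -SP.
  apply: cv; exact: continuous_reflect (continuous_poisson r01).
have Nkoo : Nk k @[k --> \oo] --> \oo.
  by move=> A [n _ nA]; exists n => // k nk; apply: nA => /=; exact: leq_trans nk (Nkk k).
have u3 : u (Nk k) @[k --> \oo] -->
    \int[mu]_(t in I) (G t * conj_poisson_deriv r (theta - t)).
  exact: (cvg_comp Nk u Nkoo u1).
rewrite (cvg_unique _ u3 u2)//.
by apply: eq_Rintegral => t _; rewrite mulrC.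
Qed.

End LipschitzFourier.

Section Stolz.
Context {R : realType}.
Implicit Types (r x t w y theta : R).

Lemma mul_cos_le_sin w : 0 <= w <= pi / 2 -> w * cos w <= sin w.
Proof.
move=> /andP[w0 wp]; pose h y : R := sin y - y * cos y.
have dh y : y \in `]0, w[%R -> is_derive y 1 h (y * sin y).
  move=> _; have := is_deriveB (is_derive_sin y)
    (is_deriveM (is_derive_id y (1 : R)) (is_derive_cos y)).
  by move/eq_is_derive; apply => //; rewrite /GRing.scale /=; ring.
have ch : {within `[0, w], continuous h}.
  apply: continuous_subspaceT => y; apply: cvgB; first exact: continuous_sin.
  by apply: cvgM; [exact: cvg_id|exact: continuous_cos].
have [c] := MVT_segment w0 dh ch.
rewrite in_itv /= => /andP[c0 cw]; rewrite /h sin0 mul0r !subr0 => e.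
rewrite -subr_ge0 e mulr_ge0// mulr_ge0// sin_ge0_pi// c0 /=.
have := @pi_ge0 R; lra.
Qed.

Lemma one_sub_cos_ge (b : R) : 0 < b < 2 * pi ->
  exists2 c : R, 0 < c & forall y, `|y| <= b -> c * y ^+ 2 <= 1 - cos y.
Proof.
move=> /andP[b0 b2].
have k0 : 0 < cos (b / 4) by apply: cos_gt0_pihalf; apply/andP; split; lra.
exists (cos (b / 4) ^+ 4 / 2); first by rewrite divr_gt0// exprn_gt0.
move=> y yb; pose w := `|y| / 4.
have w0 : 0 <= w by rewrite divr_ge0.
have wb : w <= b / 4 by rewrite ler_pM2r ?invr_gt0.
have kw : cos (b / 4) <= cos w.
  have pp := @pi_ge0 R.
  by rewrite leNgt ltr_cos ?in_itv /= -?leNgt//; apply/andP; split; lra.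
have sw : w * cos w <= sin w.
  by apply: mul_cos_le_sin; rewrite w0 /=; lra.
have yE : cos y = cos ((w *+ 2) *+ 2).
  have -> : (w *+ 2) *+ 2 = `|y| by rewrite /w !mulr2n; field.
  by case: (ger0P y) => // _; rewrite cosN.
rewrite yE cos_mulr2n cos_mulr2n -[y ^+ 2](real_normK (num_real y)).
have -> : `|y| = 4 * w by rewrite /w; field.
have cs := cos2Dsin2 w.
move: cs kw k0 sw w0; move: (cos w) (sin w) (cos (b / 4)) => c s k cs kc k0 sw w0.
have c0 : 0 <= c by apply: ltW; exact: lt_le_trans k0 kc.
have c1 : c ^+ 2 = 1 - s ^+ 2 by rewrite -cs; ring.
have -> : 1 - ((c ^+ 2 *+ 2 - 1) ^+ 2 *+ 2 - 1) = 8 * (s ^+ 2 * c ^+ 2).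
  by rewrite c1 !mulr2n; ring.
have -> : k ^+ 4 / 2 * (4 * w) ^+ 2 = 8 * (((w * k) ^+ 2) * k ^+ 2) by field.
rewrite ler_pM2l//; apply: ler_pM; rewrite ?sqr_ge0//.
  rewrite ler_pXn2r ?nnegrE ?mulr_ge0 ?(ltW k0)//; last first.
    by apply: le_trans sw; rewrite mulr_ge0.
  by apply: le_trans sw; rewrite ler_wpM2l.
by rewrite ler_pXn2r ?nnegrE// ltW.
Qed.

(* Parallelogram bound: [2 - 2 cos (x - t)] is the squared distance of e^(ix) and e^(it),
   [poisson_den r (theta - t)] that of r e^(i theta) and e^(it). *)
Lemma chord_le r theta x t :
  2 - 2 * cos (x - t) <= 2 * (poisson_den r (theta - t) + poisson_den r (theta - x)).
Proof.
have -> : x - t = (theta - t) - (theta - x) by ring.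
rewrite /poisson_den cosB; move: (theta - t) (theta - x) => a b.
have := cos2Dsin2 a; have := cos2Dsin2 b.
move: (cos a) (sin a) (cos b) (sin b) => ca sa cb sb ha hb.
have := sqr_ge0 (ca + cb - 2 * r); have := sqr_ge0 (sa + sb); nra.
Qed.

Lemma poisson_den_stolz r theta x t (C : R) : 0 <= r ->
  poisson_den r (theta - x) <= C ^+ 2 * (1 - r) ^+ 2 ->
  1 - cos (x - t) <= (1 + C ^+ 2) * poisson_den r (theta - t).
Proof.
move=> r0 hx; have := chord_le r theta x t.
have := poisson_den_ge (theta - t) r0; have := sqr_ge0 C.
move: hx; move: (poisson_den _ _) (poisson_den _ _) (C ^+ 2) => p q K; nra.
Qed.

End Stolz.

Section Fatou.
Context {R : realType}.
Notation mu := (@lebesgue_measure R).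
Notation I := (`[- pi, pi]%classic : set R).
Implicit Types (r x t theta h : R) (v : R -> R).

Lemma ball_sub_segment x h : - pi <= x - h -> x + h <= pi -> ball x h `<=` I.
Proof.
move=> h1 h2 t; rewrite /ball /= ltr_norml => /andP[? ?].
by rewrite in_itv /=; apply/andP; split; lra.
Qed.

Lemma lebesgue_pt_small_ball v x : mu.-integrable I (EFin \o v) -> - pi < x < pi ->
  lebesgue_pt (v \_ I) x -> forall e : R, 0 < e -> exists2 h0 : R, 0 < h0 &
  forall h, 0 < h < h0 ->
    \int[mu]_(t in I) (\1_(ball x h) t * `|v t - v x|) <= 2 * h * e.
Proof.
move=> iv /andP[x1 x2] lx e e0.
have /fine_cvgP[fin /cvgrPdist_lt/(_ _ e0) small] := lx.
pose h1 := Num.min (x + pi) (pi - x).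
have h10 : 0 < h1 by rewrite lt_min; apply/andP; split; lra.
have [h2 /= h20 hh2] : \forall h \near (0 : R)^'+,
    davg (v \_ I) x h \is a fin_num /\ `|0 - fine (davg (v \_ I) x h)| < e.
  by near do split.
exists (Num.min h1 h2); first by rewrite lt_min h10.
move=> h /andP[h0]; rewrite !lt_min => /andP[/andP[hx1 hx2] hh].
have [hfin] : davg (v \_ I) x h \is a fin_num /\ `|0 - fine (davg (v \_ I) x h)| < e.
  by apply: hh2 => //=; rewrite sub0r normrN gtr0_norm.
have bI : ball x h `<=` I by apply: ball_sub_segment; lra.
have mb : measurable (ball x h) by exact: measurable_ball.
have i1 : mu.-integrable I (EFin \o (fun=> v x)).
  by apply: continuous_segment_integrable => y; exact: cvg_cst.
have i2 : mu.-integrable I (EFin \o (fun t => v t - v x)) by exact: RintegrableB.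
have i3 : mu.-integrable I (EFin \o (fun t => `|v t - v x|)) by exact: (integrable_norm i2).
have i4 : mu.-integrable (ball x h) (EFin \o (fun t => `|v t - v x|)).
  exact: integrableS i3.
have xI : I x by rewrite /= in_itv /= !ltW.
have -> : \int[mu]_(t in I) (\1_(ball x h) t * `|v t - v x|) =
    \int[mu]_(t in ball x h) `|v t - v x|.
  rewrite -[in RHS](setIidr bI) Rintegral_mkcondr; apply: eq_Rintegral => t _.
  by rewrite patchE indicE; case: (t \in _); rewrite ?(mul1r, mul0r).
have -> : davg (v \_ I) x h =
    ((2 * h)^-1 * \int[mu]_(t in ball x h) `|v t - v x|)%:E.
  rewrite /davg /iavg lebesgue_measure_ball ?ltW// inver.
  rewrite mulrn_eq0 /= gt_eqF// (_ : h *+ 2 = 2 * h) ?[RHS]mulr_natl// EFinM.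
  congr (_ * _)%E; rewrite /Rintegral fineK; last by apply: integrable_fin_num.
  apply: eq_integral => t /set_mem /bI tI.
  by rewrite /= !patchE !mem_set.
rewrite sub0r normrN /= ger0_norm.
  by rewrite mulrC ltr_pdivrMr ?mulr_gt0// mulrC => /ltW.
by rewrite mulr_ge0 ?invr_ge0 ?mulr_ge0 ?(ltW h0)//; exact: Rintegral_ge0.
Unshelve. all: by end_near. Qed.

Lemma dyadic_step_cover (eta s : R) K : eta <= s -> s < 2 ^+ K * eta ->
  exists2 k, (k < K)%N & 2 ^+ k * eta <= s < 2 ^+ k.+1 * eta.
Proof.
elim: K => [|K IHK] es sK.
  by move: (le_lt_trans es sK); rewrite mul1r ltxx.
have [sK'|Ks] := ltP s (2 ^+ K * eta).
  by have [k kK ?] := IHK es sK'; exists k => //; exact: ltnW.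
by exists K => //; rewrite Ks.
Qed.

Lemma poisson_dyadic_bound r theta x t (c : R) K : 0 <= r < 1 -> 0 < c ->
  c * (x - t) ^+ 2 <= poisson_den r (theta - t) ->
  poisson r (theta - t) <= 2 / (1 - r) * \1_(ball x (1 - r)) t +
    \sum_(k < K) 2 / (c * 4 ^+ k * (1 - r)) * \1_(ball x (2 ^+ k.+1 * (1 - r))) t +
    2 / (c * 4 ^+ K * (1 - r)).
Proof.
move=> r01 c0 qc; have /andP[r0 r1] := r01; set eta := 1 - r.
have e0 : 0 < eta by rewrite subr_gt0.
have q0 := poisson_den_gt0 (theta - t) r01.
have q1 := poisson_den_ge (theta - t) r0.
have Pe : poisson r (theta - t) <= 2 * eta / poisson_den r (theta - t).
  by rewrite ler_pM2r ?invr_gt0// /eta; nra.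
have p2 k : 0 < 2 ^+ k :> R by rewrite exprn_gt0.
have p4 k : 4 ^+ k = 2 ^+ k * 2 ^+ k :> R by rewrite -exprMn; congr (_ ^+ _); ring.
have w0 k : 0 <= 2 / (c * 4 ^+ k * eta).
  by rewrite divr_ge0// !mulr_ge0// ?exprn_ge0// ltW.
have wk k : 2 ^+ k * eta <= `|x - t| -> poisson r (theta - t) <= 2 / (c * 4 ^+ k * eta).
  move=> hk; apply: (le_trans Pe); rewrite ler_pdivrMr//.
  have h1 : c * ((2 ^+ k * eta) * (2 ^+ k * eta)) <= poisson_den r (theta - t).
    apply: le_trans qc; rewrite ler_pM2l// -(real_normK (num_real (x - t))) expr2.
    by rewrite ler_pM// mulr_ge0// ltW.
  apply: (@le_trans _ _ (2 / (c * 4 ^+ k * eta) * (c * ((2 ^+ k * eta) * (2 ^+ k * eta))))).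
    rewrite p4 le_eqVlt; apply/orP; left; apply/eqP; field.
    by rewrite !lt0r_neq0.
  by rewrite ler_wpM2l.
have i0 A : 0 <= \1_A t :> R by rewrite indicE.
have s0 : 0 <= \sum_(k < K) 2 / (c * 4 ^+ k * eta) * \1_(ball x (2 ^+ k.+1 * eta)) t.
  by apply: sumr_ge0 => k _; rewrite mulr_ge0.
have [lt1|ge1] := ltP `|x - t| eta.
  rewrite indicE mem_set// mulr1 -addrA ler_wpDr//; first by rewrite addr_ge0.
  apply: (le_trans Pe); rewrite ler_pdivrMr// mulrAC ler_pdivlMr//.
  by rewrite -mulrA ler_pM2l// -expr2.
have [lt2|ge2] := ltP `|x - t| (2 ^+ K * eta); last first.
  apply: (le_trans (wk _ ge2)); rewrite ler_wpDl// addr_ge0// mulr_ge0//.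
  by rewrite divr_ge0// ltW.
have [k kK /andP[k1 k2]] := dyadic_step_cover ge1 lt2.
apply: (le_trans (wk _ k1)).
rewrite -addrA ler_wpDl//; first by rewrite mulr_ge0// divr_ge0// ltW.
rewrite ler_wpDr// (bigD1 (Ordinal kK))//= indicE mem_set// mulr1 ler_wpDr//.
by apply: sumr_ge0 => j _; rewrite mulr_ge0.
Qed.

Lemma poisson_fatou v x (C : R) : mu.-integrable I (EFin \o v) -> - pi < x < pi ->
  lebesgue_pt (v \_ I) x -> forall e : R, 0 < e -> exists2 d : R, 0 < d &
  forall r theta, 0 <= r < 1 -> 1 - r < d ->
    poisson_den r (theta - x) <= C ^+ 2 * (1 - r) ^+ 2 ->
    `|\int[mu]_(t in I) (v t * poisson r (theta - t)) - 2 * pi * v x| <= e.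
Proof.
move=> iv xpi lx e e0; have /andP[x1 x2] := xpi; have p0 := @pi_gt0 R.
have [|c c0 hc] := @one_sub_cos_ge R (pi + `|x|).
  rewrite ltr_wpDr//= mulr_natl mulr2n ltrD2l ltr_norml; apply/andP; split; lra.
have C1 : 0 < 1 + C ^+ 2 by rewrite ltr_wpDr ?sqr_ge0.
pose c1 := c / (1 + C ^+ 2); have c10 : 0 < c1 by rewrite divr_gt0.
pose f (t : R) : R := `|v t - v x|.
have i1 : mu.-integrable I (EFin \o (fun=> v x)).
  by apply: continuous_segment_integrable => y; exact: cvg_cst.
have i2 : mu.-integrable I (EFin \o (fun t => v t - v x)) by exact: RintegrableB.
have fi : mu.-integrable I (EFin \o f) by exact: (integrable_norm i2).
pose S := \int[mu]_(t in I) f t; have S0 : 0 <= S.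
  by apply: Rintegral_ge0 => t _; exact: normr_ge0.
pose ep := e / (2 * (4 + 16 / c1)).
have cc0 : 0 < 4 + 16 / c1 by rewrite addr_gt0// divr_gt0.
have ep0 : 0 < ep by rewrite divr_gt0// mulr_gt0.
have [h0 h00 small] := lebesgue_pt_small_ball iv xpi lx ep0.
pose d := Num.min h0 (e / 2 * (c1 * h0 ^+ 2) / (8 * (S + 1))).
have S1 : 0 < S + 1 by rewrite ltr_wpDl.
exists d.
  rewrite lt_min h00 /=; apply: divr_gt0; last by lra.
  by apply: mulr_gt0; [lra|apply: mulr_gt0 => //; exact: exprn_gt0].
move=> r theta r01; rewrite lt_min => /andP[rd1 rd2] hq.
have /andP[r0 r1] := r01; set eta := 1 - r in rd1 rd2 *.
have eta0 : 0 < eta by rewrite subr_gt0.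
have cP : continuous (fun t => poisson r (theta - t)).
  exact: continuous_reflect (continuous_poisson r01).
have P0 t : 0 <= poisson r (theta - t).
  rewrite divr_ge0//; last exact/ltW/poisson_den_gt0.
  by rewrite subr_ge0 exprn_ile1// ltW.
have [B PB] : exists B : R, forall t, I t -> `|poisson r (theta - t)| <= B.
  exists (2 / eta) => t It; rewrite ger0_norm//.
  have q1 := poisson_den_ge (theta - t) r0.
  rewrite ler_pdivrMr ?poisson_den_gt0// mulrAC ler_pdivlMr//.
  have := mulr_ge0 (ltW eta0) (sqr_ge0 eta).
  by rewrite /eta in eta0 q1 *; nra.
have iP (w : R -> R) : mu.-integrable I (EFin \o w) ->
    mu.-integrable I (EFin \o (fun t => w t * poisson r (theta - t))).
  move=> iw; have := Rintegrable_bddM _ (continuous_measurable cP) PB iw.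
  move=> /(_ (measurable_itv _)); apply: eq_Rintegrable => // t _; exact: mulrC.
have -> : \int[mu]_(t in I) (v t * poisson r (theta - t)) - 2 * pi * v x =
    \int[mu]_(t in I) ((v t - v x) * poisson r (theta - t)).
  rewrite -(integral_poisson theta r01) [_ * v x]mulrC -RintegralZl//; last first.
    exact: continuous_segment_integrable.
  rewrite -RintegralB//; [|exact: iP..].
  by apply: eq_Rintegral => t _; ring.
apply: (le_trans (le_normr_Rintegral _ (iP _ i2))) => //.
have [K Kl Kr] : exists2 K, 2 ^+ K * eta < h0 & h0 <= 2 ^+ K.+1 * eta.
  have ex : exists n, h0 <= 2 ^+ n * eta.
    exists (Num.truncn (h0 / eta)).+1; rewrite -ler_pdivrMr//.
    have /andP[_ /ltW] := truncn_itv (divr_ge0 (ltW h00) (ltW eta0)).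
    move/le_trans; apply; rewrite -natrX ler_nat.
    exact/ltnW/ltn_expl.
  case: (ex_minnP ex) => -[|m] hm mm.
    by move: hm; rewrite mul1r leNgt rd1.
  by exists m => //; rewrite ltNge; apply/negP => /mm; rewrite ltnn.
pose w0 := 2 / eta; pose w (k : nat) := 2 / (c1 * 4 ^+ k * eta).
pose b0 t := \1_(ball x eta) t * f t.
pose b (k : nat) t := \1_(ball x (2 ^+ k.+1 * eta)) t * f t.
have ib (A : set R) : measurable A -> mu.-integrable I (EFin \o (fun t => \1_A t * f t)).
  move=> mA; apply: (@Rintegrable_bddM _ I (\1_A : R -> R) f 1) => // t _.
  by rewrite indicE; case: (t \in A); rewrite ?normr0 ?normr1.
have ib0 : mu.-integrable I (EFin \o b0) by apply: ib; exact: measurable_ball.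
have ibk k : mu.-integrable I (EFin \o b k) by apply: ib; exact: measurable_ball.
have ibw k : mu.-integrable I (EFin \o (fun t => w k * b k t)) by exact: RintegrableZl.
have [isum esum] := @Rintegral_sum _ I (fun k t => w k * b k t) K (measurable_itv _)
  (fun k _ => ibw k).
apply: (@le_trans _ _ (\int[mu]_(t in I)
    (w0 * b0 t + \sum_(k < K) w k * b k t + w K * f t))).
  apply: le_Rintegral => //.
  - exact: (integrable_norm (iP _ i2)).
  - by apply: RintegrableD => //; [apply: RintegrableD => //|]; exact: RintegrableZl.
  - move=> t It; rewrite normrM [X in _ * X]ger0_norm// -/(f t).
    have hd : c1 * (x - t) ^+ 2 <= poisson_den r (theta - t).
      rewrite /c1 mulrAC ler_pdivrMr// [leRHS]mulrC.
      apply: le_trans (poisson_den_stolz t r0 hq); apply: hc.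
      rewrite (le_trans (ler_normB _ _))// addrC lerD2r ler_norml.
      by move: It; rewrite /= in_itv.
    have := poisson_dyadic_bound K r01 c10 hd; rewrite -/eta => hb.
    have f0 : 0 <= f t by exact: normr_ge0.
    apply: (le_trans (ler_wpM2l f0 hb)).
    rewrite le_eqVlt; apply/orP; left; apply/eqP.
    rewrite mulrDr mulrDr mulr_sumr; congr (_ + _ + _).
    - by rewrite /b0 /w0; ring.
    - by apply: eq_bigr => k _; rewrite /b /w; ring.
    - by rewrite /w; ring.
rewrite RintegralD//; [|by apply: RintegrableD => //; exact: RintegrableZl|exact: RintegrableZl].
rewrite RintegralD//; last exact: RintegrableZl.
rewrite esum !RintegralZl//.
have p2 k : 0 < 2 ^+ k :> R by rewrite exprn_gt0.
have p4 k : 4 ^+ k = 2 ^+ k * 2 ^+ k :> R by rewrite -exprMn; congr (_ ^+ _); ring.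
have wk0 k : 0 <= w k.
  by apply: divr_ge0 => //; rewrite mulr_ge0 ?(ltW eta0)// mulr_ge0 ?(ltW c10)// exprn_ge0.
have t0 : w0 * \int[mu]_(t in I) b0 t <= 4 * ep.
  have : \int[mu]_(t in I) b0 t <= 2 * eta * ep by apply: small; rewrite eta0.
  move/(ler_wpM2l (ltW (divr_gt0 (ltr0n R 2) eta0))) => /le_trans; apply.
  by rewrite le_eqVlt; apply/orP; left; apply/eqP; field; exact: lt0r_neq0.
have tk : \sum_(k < K) \int[mu]_(t in I) (w k * b k t) <= 16 / c1 * ep.
  apply: (@le_trans _ _ (\sum_(k < K) 8 / c1 * ep * (2^-1) ^+ k)).
    apply: ler_sum => k _; rewrite RintegralZl//.
    have : \int[mu]_(t in I) b k t <= 2 * (2 ^+ k.+1 * eta) * ep.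
      apply: small; rewrite mulr_gt0//=; apply: le_lt_trans Kl.
      by rewrite ler_pM2r// ler_weXn2l// ler1n.
    move/(ler_wpM2l (wk0 k)) => /le_trans; apply.
    rewrite le_eqVlt; apply/orP; left; apply/eqP; rewrite /w p4 exprS exprVn; field.
    by rewrite !lt0r_neq0.
  have -> : \sum_(k < K) 8 / c1 * ep * 2^-1 ^+ k = 16 / c1 * ep * (1 - 2^-1 ^+ K).
    elim: (K) => [|n IHn]; first by rewrite big_ord0 expr0 subrr mulr0.
    rewrite big_ord_recr /= IHn exprS; field.
    exact: lt0r_neq0.
  have h16 : 0 <= 16 / c1 * ep.
    by apply: mulr_ge0; [apply: divr_ge0 => //; exact: ltW|exact: ltW].
  by rewrite ler_piMr// gerBl exprn_ge0// invr_ge0.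
have tK : w K * S <= e / 2.
  have ch0 : 0 < c1 * h0 ^+ 2 by apply: mulr_gt0 => //; exact: exprn_gt0.
  have wKle : w K <= 8 * eta / (c1 * h0 ^+ 2).
    rewrite ler_pdivlMr//.
    have h0K : h0 ^+ 2 <= (2 ^+ K.+1 * eta) * (2 ^+ K.+1 * eta).
      by rewrite expr2 ler_pM// ltW.
    apply: (le_trans (ler_wpM2l (wk0 K) (ler_wpM2l (ltW c10) h0K))).
    rewrite le_eqVlt; apply/orP; left; apply/eqP; rewrite /w p4 exprS; field.
    by rewrite !lt0r_neq0.
  apply: (@le_trans _ _ (8 * eta / (c1 * h0 ^+ 2) * (S + 1))).
    by apply: (ler_pM (wk0 K) S0 wKle); rewrite lerDl.
  move: rd2; rewrite ltr_pdivlMr ?mulr_gt0// => /ltW rd2.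
  rewrite mulrAC ler_pdivrMr//.
  by apply: le_trans rd2; rewrite le_eqVlt; apply/orP; left; apply/eqP; ring.
have epE : 4 * ep + 16 / c1 * ep = e / 2.
  rewrite /ep; field; rewrite !lt0r_neq0//.
  by rewrite addr_gt0// mulr_gt0.
rewrite -/S; lra.
Qed.

End Fatou.

Section Marcinkiewicz.
Context {R : realType}.
Notation mu := (@lebesgue_measure R).
Notation I := (`[- pi, pi]%classic : set R).
Implicit Types (x t s : R) (b : R -> R).

(* Comparable to [b t / (x - t) ^+ 2] where [b t <= c * |x - t|], yet its integral in [x] over
   the line is at most [pi * c]; it is [0] when [b t = 0], also for [x = t]. *)
Definition marcinkiewicz_kernel (c : R) b x t := b t / ((x - t) ^+ 2 + (b t / c) ^+ 2).

Lemma marcinkiewicz_kernel_integral (c : R) b t : 0 < c -> 0 <= b t ->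
  mu.-integrable I (EFin \o (marcinkiewicz_kernel c b ^~ t)) /\
  \int[mu]_(x in I) marcinkiewicz_kernel c b x t <= pi * c.
Proof.
move=> c0; rewrite le_eqVlt => /predU1P[b0|b0].
  have -> : marcinkiewicz_kernel c b ^~ t = fun=> 0.
    by apply/funext => x; rewrite /marcinkiewicz_kernel -b0 mul0r.
  split; first by apply: continuous_segment_integrable => x; exact: cvg_cst.
  by rewrite Rintegral_cst// mul0r mulr_ge0 ?pi_ge0 ?ltW.
pose s := b t / c; have s0 : 0 < s by rewrite divr_gt0.
have den x : 0 < (x - t) ^+ 2 + s ^+ 2.
  by rewrite ltr_wpDl ?sqr_ge0// exprn_gt0.
have ck : continuous (marcinkiewicz_kernel c b ^~ t).
  move=> x; apply: cvgM; first exact: cvg_cst.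
  apply: cvgV; first exact/lt0r_neq0/den.
  apply: cvgD; last exact: cvg_cst.
  have h : (x0 - t) @[x0 --> x] --> x - t by apply: cvgB; [exact: cvg_id|exact: cvg_cst].
  exact: (cvgM h h).
split; first exact: continuous_segment_integrable.
have dF (x : R) : is_derive x 1 (fun x => c * atan ((x - t) / s)) (marcinkiewicz_kernel c b x t).
  have d1 : is_derive x 1 (fun x => (x - t) / s) (s^-1).
    have := is_deriveM (is_deriveB (is_derive_id x (1 : R)) (is_derive_cst t x 1))
      (is_derive_cst s^-1 x 1).
    by move/eq_is_derive; apply => //; rewrite /GRing.scale /=; ring.
  have d2 := @is_derive1_comp _ atan (fun x => (x - t) / s) x _ _
    (is_derive1_atan ((x - t) / s)) d1.
  have := is_deriveM (is_derive_cst c x 1) d2.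
  move/eq_is_derive; apply => //; rewrite /GRing.scale /= mulr0 addr0.
  rewrite /marcinkiewicz_kernel -/s; have bE : b t = s * c by rewrite /s divfK// gt_eqF.
  have dn := lt0r_neq0 (den x); have sn := lt0r_neq0 s0.
  rewrite bE; field; rewrite sn /=.
  by rewrite dn.
rewrite (Rintegral_FTC2 (@oppi_le_pi R) ck dF) -mulrBr mulrC ler_pM2r//.
have := atan_ltpi2 ((pi - t) / s); have := atan_gtNpi2 ((- pi - t) / s); lra.
Qed.

Lemma measurable_marcinkiewicz_kernel (c : R) b : measurable_fun setT b ->
  measurable_fun setT (fun z : R * R => marcinkiewicz_kernel c b z.1 z.2).
Proof.
move=> mb.
have mb2 : measurable_fun setT (fun z : R * R => b z.2).
  by apply: (measurableT_comp mb); exact: measurable_snd.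
apply: measurable_funM => //; apply: (measurableT_comp (@measurable_inv R)).
apply: measurable_funD; apply: measurable_funX.
  by apply: measurable_funB; [exact: measurable_fst|exact: measurable_snd].
by apply: measurable_funM => //; exact: measurable_cst.
Qed.

Lemma marcinkiewicz_ae (c : R) b : 0 < c -> measurable_fun setT b ->
  (forall t, 0 <= b t) ->
  {ae mu, forall x, I x -> mu.-integrable I (EFin \o marcinkiewicz_kernel c b x)}.
Proof.
move=> c0 mb b0; pose k := marcinkiewicz_kernel c b.
have k0 x t : 0 <= k x t by rewrite divr_ge0// addr_ge0// sqr_ge0.
pose f (z : R * R) := ((\1_I z.1 * \1_I z.2) * k z.1 z.2)%:E.
have mI : measurable_fun setT (\1_I : R -> R) by exact: measurable_indic.
have mf : measurable_fun setT f.
  apply/measurable_EFinP; apply: measurable_funM; last exact: measurable_marcinkiewicz_kernel.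
  apply: measurable_funM.
    by apply: (measurableT_comp mI); exact: measurable_fst.
  by apply: (measurableT_comp mI); exact: measurable_snd.
have f0 z : (0 <= f z)%E.
  by rewrite lee_fin; apply: mulr_ge0 => //; apply: mulr_ge0; rewrite indicE.
have iI : mu.-integrable setT (EFin \o (fun t => pi * c * \1_I t)).
  apply: (@eq_Rintegrable _ _ ((fun=> pi * c : R) \_ I)) => //.
    by move=> t _; rewrite patchE indicE; case: (t \in I); rewrite ?mulr1 ?mulr0.
  rewrite -restrict_EFin; apply/integrable_restrict => //; rewrite setTI.
  by apply: continuous_segment_integrable => t; exact: cvg_cst.
have fi : (mu \x mu)%E.-integrable setT f.
  apply/integrable21ltyP => //.
  apply: (@le_lt_trans _ _ (\int[mu]_t (pi * c * \1_I t)%:E)%E); last first.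
    exact: integrable_lty iI.
  have mG := @measurable_fun_fubini_tonelli_G _ _ _ _ _ mu (abse \o f)
    (measurableT_comp (@abse_measurable _ _) mf) (fun _ => abse_ge0 _).
  apply: ge0_le_integral => //.
  - by move=> t _; apply: integral_ge0.
  - by apply/measurable_EFinP; apply: measurable_funM => //; exact: measurable_cst.
  - move=> t _.
    have [ik kle] := marcinkiewicz_kernel_integral c0 (b0 t).
    under eq_integral do rewrite gee0_abs//.
    have [It|It] := boolP (t \in I); last first.
      rewrite integral0_eq; first by rewrite indicE (negbTE It) mulr0.
      by move=> x _; rewrite /f /= [\1_I t]indicE (negbTE It) mulr0 mul0r.
    rewrite (_ : (fun x => f (x, t)) = (EFin \o (k ^~ t)) \_ I); last first.
      apply/funext => x; rewrite patchE /f /= !indicE It mulr1.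
      by case: (x \in I); rewrite ?mul1r ?mul0r.
    rewrite -integral_mkcond indicE It mulr1 -[leLHS]fineK ?lee_fin//.
    exact: integrable_fin_num.
have := ae_integrable1 fi; apply: lebesgue_ae_imply => x ix Ix.
have : mu.-integrable I (fun t => f (x, t)) by exact: integrableS ix.
apply: eq_integrable => // t It.
by rewrite /f /= !indicE It mem_set// !mul1r.
Qed.
End Marcinkiewicz.

Section LipschitzPart.
Context {R : realType}.
Notation mu := (@lebesgue_measure R).
Variables (Phi : R -> R) (M : R).
Hypothesis PhiM : forall t, `|Phi t| <= M.
Hypothesis Phi_periodic : periodic Phi (2 * pi).
Implicit Types (x y t : R) (N : nat).

Definition lipschitz_pt N : set R :=
  [set x | forall y, `|Phi y - Phi x| <= N%:R * `|y - x|].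

Lemma lipschitz_pt_continuous N x : lipschitz_pt N x -> {for x, continuous Phi}.
Proof.
move=> h; apply/cvgrPdist_lt => e e0.
have N1 : 0 < N.+1%:R :> R by rewrite ltr0n.
exists (e / N.+1%:R); first by rewrite /= divr_gt0.
move=> y /= xy; rewrite distrC; apply: (le_lt_trans (h y)).
apply: (@le_lt_trans _ _ (N.+1%:R * `|y - x|)); first by rewrite ler_wpM2r// ler_nat.
by rewrite mulrC -ltr_pdivlMr// distrC.
Qed.

Lemma closed_lipschitz_pt N : closed (lipschitz_pt N).
Proof.
move=> x clx.
move=> y; apply/ler_addgt0Pl => e e0.
have N1 : 0 < N.+1%:R :> R by rewrite ltr0n.
have d0 : 0 < e / (2 * N.+1%:R) by rewrite divr_gt0 ?mulr_gt0.
have [x' [Ex' /= xx']] := clx _ (nbhsx_ballx x _ d0).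
rewrite /ball /= ltr_pdivlMr ?mulr_gt0// -natr1 in xx'.
have := Ex' y; have := Ex' x.
have := ler_normB (Phi y - Phi x') (Phi x - Phi x').
rewrite (_ : Phi y - Phi x' - (Phi x - Phi x') = Phi y - Phi x); last by ring.
have yx' : N%:R * `|y - x'| <= N%:R * (`|y - x| + `|x - x'|).
  by rewrite ler_wpM2l// (_ : y - x' = (y - x) + (x - x')) ?ler_normD//; ring.
have := normr_ge0 (x - x'); move: xx' yx'.
move: (`|x - x'|) (`|y - x|) => d D; nra.
Qed.

Lemma lipschitz_ptD2pi N x : lipschitz_pt N (x + 2 * pi) <-> lipschitz_pt N x.
Proof.
split=> h y.
  have := h (y + 2 * pi); rewrite !Phi_periodic.
  by rewrite (_ : y + 2 * pi - (x + 2 * pi) = y - x); [|ring].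
have := h (y - 2 * pi); have := Phi_periodic (y - 2 * pi); rewrite subrK Phi_periodic => ->.
by rewrite (_ : y - 2 * pi - x = y - (x + 2 * pi)); [|ring].
Qed.

Lemma derivable_lipschitz_pt x : derivable Phi x 1 -> exists N, lipschitz_pt N x.
Proof.
move=> dPhi; have M0 : 0 <= M := le_trans (normr_ge0 _) (PhiM 0).
have /cvgrPdist_lt/(_ 1 ltr01) [d /= d0 hd] : h^-1 *: (Phi (h *: 1 + x) - Phi x)
    @[h --> (0 : R)^'] --> 'D_1 Phi x by exact: dPhi.
pose K := `|'D_1 Phi x| + 1 + 2 * M / d.
have K0 : 0 <= K by rewrite !addr_ge0// divr_ge0 ?mulr_ge0// ltW.
exists (Num.truncn K).+1 => y.
have KN : K <= (Num.truncn K).+1%:R by have /andP[_ /ltW] := truncn_itv K0.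
apply: (@le_trans _ _ (K * `|y - x|)); last by rewrite ler_wpM2r.
have [->|yx] := eqVneq y x; first by rewrite !subrr normr0 mulr0.
have yx0 : 0 < `|y - x| by rewrite normr_gt0 subr_eq0.
have [yd|dy] := ltP `|y - x| d.
  have := hd (y - x); rewrite /= sub0r normrN => /(_ yd); rewrite subr_eq0 => /(_ yx).
  rewrite /GRing.scale /= mulr1 subrK => h.
  have : `|(y - x)^-1 * (Phi y - Phi x)| <= `|'D_1 Phi x| + 1.
    have := ler_normB ('D_1 Phi x) ('D_1 Phi x - (y - x)^-1 * (Phi y - Phi x)).
    by rewrite (_ : 'D_1 Phi x - ('D_1 Phi x - _) = (y - x)^-1 * (Phi y - Phi x));
       [lra|ring].
  rewrite normrM normfV mulrC ler_pdivrMr// => /le_trans; apply.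
  by rewrite ler_wpM2r// /K lerDl divr_ge0 ?mulr_ge0// ltW.
apply: (@le_trans _ _ (2 * M)).
  by rewrite (le_trans (ler_normB _ _))//; have := PhiM y; have := PhiM x; lra.
apply: (@le_trans _ _ (2 * M / d * `|y - x|)).
  by rewrite mulrAC ler_pdivlMr// ler_wpM2l// mulr_ge0.
by rewrite ler_wpM2r// /K lerDr addr_ge0.
Qed.

(* McShane's extension, cut off at [M] to keep it bounded. *)
Lemma lipschitz_extension N : lipschitz_pt N !=set0 -> exists G : R -> R,
  [/\ forall x y, `|G x - G y| <= N%:R * `|x - y|, forall x, `|G x| <= M,
      G pi = G (- pi), forall x, lipschitz_pt N x -> G x = Phi x &
      forall x t, lipschitz_pt N x -> `|Phi t - G t| <= 2 * N%:R * `|x - t|].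
Proof.
move=> [y0 hy0]; pose E := lipschitz_pt N.
pose S x := [set Phi y + N%:R * `|x - y| | y in E].
have Slb x : lbound (S x) (- M).
  move=> _ [y _ <-]; have := PhiM y; rewrite ler_norml => /andP[h _].
  by rewrite (le_trans h)// lerDl mulr_ge0.
have S0 x : S x !=set0 by exists (Phi y0 + N%:R * `|x - y0|), y0.
have Sinf x : has_inf (S x) by split => //; exists (- M); exact: Slb.
pose g x := inf (S x).
have gle x y : E y -> g x <= Phi y + N%:R * `|x - y|.
  by move=> Ey; apply: ge_inf; [exists (- M); exact: Slb|exists y].
have gL x x' : g x <= g x' + N%:R * `|x - x'|.
  rewrite -lerBlDr; apply: lb_le_inf => // _ [y Ey <-]; rewrite lerBlDr.
  apply: (le_trans (gle x y Ey)); rewrite -addrA lerD2l -mulrDr ler_wpM2l//.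
  by rewrite (_ : x - y = (x' - y) + (x - x')) ?ler_normD//; ring.
have gM x : - M <= g x by apply: lb_le_inf => //; exact: Slb.
have gE x : E x -> g x = Phi x.
  move=> Ex; apply/le_anti/andP; split.
    by have := gle x x Ex; rewrite subrr normr0 mulr0 addr0.
  apply: lb_le_inf => // _ [y Ey <-]; have := Ey x.
  by rewrite ler_norml => /andP[_]; rewrite lerBlDl.
pose G x := Num.min M (g x).
have GE x : E x -> G x = Phi x.
  move=> Ex; rewrite /G gE//; apply/min_idPr.
  by have := PhiM x; rewrite ler_norml => /andP[].
have GL x y : `|G x - G y| <= N%:R * `|x - y|.
  have h a b : G a <= G b + N%:R * `|a - b|.
    have ab0 : 0 <= N%:R * `|a - b| by rewrite mulr_ge0.
    rewrite [G b]/G minEle; case: ifP => _.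
      by apply: (@le_trans _ _ M); rewrite ?lerDl// /G ge_min lexx.
    by apply: le_trans (gL a b); rewrite /G ge_min lexx orbT.
  have := h x y; have := h y x; rewrite distrC => h1 h2.
  by rewrite ler_norml; apply/andP; split; lra.
exists G; split => //.
- move=> x; rewrite ler_norml /G le_min gM ge_min lexx /= andbT.
  by have M0 := le_trans (normr_ge0 _) (PhiM 0); lra.
- rewrite /G /g; congr (Num.min M (inf _)); apply/seteqP; split => _ [y Ey <-].
    exists (y - 2 * pi); first by apply/lipschitz_ptD2pi; rewrite subrK.
    have := Phi_periodic (y - 2 * pi); rewrite subrK => ->.
    by congr (_ + _ * `|_|); ring.
  exists (y + 2 * pi); first exact/lipschitz_ptD2pi.
  by rewrite Phi_periodic; congr (_ + _ * `|_|); ring.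
- move=> x t Ex; have -> : Phi t - G t = (Phi t - Phi x) - (G t - G x).
    by rewrite (GE x Ex); ring.
  rewrite (le_trans (ler_normB _ _))// [`|x - t|]distrC.
  by have := Ex t; have := GL t x; lra.
Qed.

Definition lipschitz_set : set R := \bigcup_N lipschitz_pt N.

Lemma measurable_lipschitz_set : measurable lipschitz_set.
Proof.
by apply: bigcup_measurable => N _; apply: closed_measurable; exact: closed_lipschitz_pt.
Qed.

Lemma measurable_restrict_lipschitz_set : measurable_fun setT (Phi \_ lipschitz_set).
Proof.
have mE N : measurable (lipschitz_pt N) by apply: closed_measurable; exact: closed_lipschitz_pt.
apply/(measurable_restrictT _ measurable_lipschitz_set); apply/measurable_fun_bigcup => // N.
have [N0|] := pselect (lipschitz_pt N !=set0).
  have [G [GL _ _ GE _]] := lipschitz_extension N0.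
  apply: (@eq_measurable_fun _ _ _ _ _ G); first by move=> x /set_mem /GE.
  by apply: continuous_measurable; exact: (lipschitz_continuous GL).
move=> /set0P/negP/negPn/eqP ->; exact: measurable_fun_set0.
Qed.

End LipschitzPart.

Section StolzLimit.
Context {R : realType}.
Notation mu := (@lebesgue_measure R).
Notation I := (`[- pi, pi]%classic : set R).
Implicit Types (x t c C : R) (r theta : R^nat) (beta : R -> R).

(* The points r n e^(i theta n) tend to e^(ix) inside a Stolz angle with aperture [C]. *)
Definition stolz_seq C x r theta : Prop :=
  [/\ forall n, 0 <= r n < 1, r n @[n --> \oo] --> (1 : R) &
      forall n, poisson_den (r n) (theta n - x) <= C ^+ 2 * (1 - r n) ^+ 2].

Lemma conj_poisson_deriv_le (r y : R) : 0 <= r < 1 ->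
  `|conj_poisson_deriv r y| <= 6 / poisson_den r y.
Proof.
move=> r01; have /andP[r0 r1] := r01.
have q0 := poisson_den_gt0 y r01; have := poisson_den_ge y r0.
rewrite /conj_poisson_deriv; move: (poisson_den r y) q0 => q q0 hq.
have qn := lt0r_neq0 q0.
have -> : (1 - r ^+ 2) ^+ 2 / q ^+ 2 - (1 + r ^+ 2) / q =
    ((1 - r ^+ 2) ^+ 2 / q - (1 + r ^+ 2)) / q by field.
rewrite normrM [`|q^-1|]gtr0_norm ?invr_gt0// ler_pM2r ?invr_gt0//.
have h1 : 0 <= (1 - r ^+ 2) ^+ 2 / q by rewrite divr_ge0 ?sqr_ge0 ?ltW.
have h2 : (1 - r ^+ 2) ^+ 2 / q <= 4.
  rewrite ler_pdivrMr//; apply: (@le_trans _ _ (4 * (1 - r) ^+ 2)); last by rewrite ler_pM2l.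
  have -> : (1 - r ^+ 2) ^+ 2 = (1 + r) ^+ 2 * (1 - r) ^+ 2 by ring.
  by rewrite ler_wpM2r ?sqr_ge0//; nra.
have h3 : 0 <= r ^+ 2 <= 1 by rewrite sqr_ge0 exprn_ile1// ltW.
by rewrite ler_norml; apply/andP; split; lra.
Qed.

Lemma stolz_seq_cos C x r theta t : stolz_seq C x r theta ->
  cos (theta n - t) @[n --> \oo] --> cos (x - t).
Proof.
move=> [r01 r1 hq].
have q0 : poisson_den (r n) (theta n - x) @[n --> \oo] --> (0 : R).
  have h : (1 - r n) @[n --> \oo] --> (0 : R).
    by rewrite -[X in _ --> X](subrr 1); apply: cvgB => //; exact: cvg_cst.
  have h2 : (C ^+ 2 * (1 - r n) ^+ 2) @[n --> \oo] --> (0 : R).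
    rewrite -[X in _ --> X](mulr0 (C ^+ 2)); apply: cvgM; first exact: cvg_cst.
    by rewrite -[X in _ --> X](mulr0 0); exact: (cvgM h h).
  apply: (squeeze_cvgr _ _ h2); last exact: cvg_cst.
  by apply: nearW => n; rewrite hq andbT ltW// poisson_den_gt0.
have c1 : cos (theta n - x) @[n --> \oo] --> (1 : R).
  have h : (1 - poisson_den (r n) (theta n - x)) @[n --> \oo] --> (1 : R).
    by rewrite -[X in _ --> X]subr0; apply: cvgB => //; exact: cvg_cst.
  apply: (squeeze_cvgr _ h); last exact: cvg_cst.
  have r2 : \forall n \near \oo, `|1 - r n| < 1 / 2.
    by have /cvgrPdist_lt := r1; apply; rewrite divr_gt0.
  near=> n; rewrite cos_le1 andbT.
  have : `|1 - r n| < 1 / 2 by near: n.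
  have /andP[_ rn1] := r01 n; rewrite ger0_norm ?subr_ge0 ?(ltW rn1)// => rn.
  rewrite /poisson_den; have := cos_le1 (theta n - x); have := sqr_ge0 (1 - r n).
  by move: (cos _) => c; nra.
have s0 : sin (theta n - x) @[n --> \oo] --> (0 : R).
  apply/cvgrPdist_lt => e e0.
  have e2 : 0 < e ^+ 2 / 2 by rewrite divr_gt0// exprn_gt0.
  have /cvgrPdist_lt/(_ _ e2) := c1; apply: filterS => n.
  rewrite ger0_norm ?subr_ge0 ?cos_le1// sub0r normrN => h.
  rewrite -(@ltr_pXn2r _ 2)// ?nnegrE ?ltW// real_normK ?num_real//.
  have := cos2Dsin2 (theta n - x); have := cos_le1 (theta n - x).
  by move: h; move: (cos _) (sin _) => c s; nra.
have -> : (fun n => cos (theta n - t)) =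
    fun n => cos (theta n - x) * cos (x - t) - sin (theta n - x) * sin (x - t).
  by apply/funext => n; rewrite -cosD; congr cos; ring.
rewrite -[X in _ --> X]subr0 -[in X in _ --> X](mul1r (cos (x - t))).
rewrite -[in X in _ --> X](mul0r (sin (x - t))).
by apply: cvgB; apply: cvgM => //; exact: cvg_cst.
Unshelve. all: by end_near. Qed.

Lemma conj_poisson_deriv_cvg C x r theta t : stolz_seq C x r theta ->
  cos (x - t) != 1 ->
  conj_poisson_deriv (r n) (theta n - t) @[n --> \oo] --> - (1 - cos (x - t))^-1.
Proof.
move=> hs ct; have cc := stolz_seq_cos (t := t) hs; have [_ r1 _] := hs.
have r2 : (r n ^+ 2) @[n --> \oo] --> (1 : R).
  by rewrite -[X in _ --> X](mulr1 1); exact: (cvgM r1 r1).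
have cq : poisson_den (r n) (theta n - t) @[n --> \oo] --> 2 * (1 - cos (x - t)).
  have -> : 2 * (1 - cos (x - t)) = 1 - 2 * 1 * cos (x - t) + 1 by ring.
  apply: cvgD => //; apply: cvgB; first exact: cvg_cst.
  by apply: cvgM => //; apply: cvgM => //; exact: cvg_cst.
have q0 : 2 * (1 - cos (x - t)) != 0.
  by rewrite mulf_neq0 ?pnatr_eq0// subr_eq0 eq_sym.
have iq : (poisson_den (r n) (theta n - t))^-1 @[n --> \oo] -->
    (2 * (1 - cos (x - t)))^-1 by apply: cvgV.
have a0 : ((1 - r n ^+ 2) ^+ 2) @[n --> \oo] --> (0 : R).
  have h : (1 - r n ^+ 2) @[n --> \oo] --> (0 : R).
    by rewrite -[X in _ --> X](subrr 1); apply: cvgB => //; exact: cvg_cst.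
  by rewrite -[X in _ --> X](mulr0 0); exact: (cvgM h h).
have -> : - (1 - cos (x - t))^-1 =
    0 * ((2 * (1 - cos (x - t)))^-1 * (2 * (1 - cos (x - t)))^-1) -
    (1 + 1) * (2 * (1 - cos (x - t)))^-1.
  by field; rewrite subr_eq0 eq_sym.
apply: cvgB.
  have -> : (fun n => (1 - r n ^+ 2) ^+ 2 / poisson_den (r n) (theta n - t) ^+ 2) =
    fun n => (1 - r n ^+ 2) ^+ 2 * ((poisson_den (r n) (theta n - t))^-1 *
      (poisson_den (r n) (theta n - t))^-1).
    by apply/funext => n; rewrite expr2 invfM.
  by apply: cvgM => //; exact: (cvgM iq iq).
by apply: cvgM => //; apply: cvgD => //; exact: cvg_cst.
Qed.

Lemma marcinkiewicz_limit beta c x : measurable_fun setT beta -> 0 < c ->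
  {ae mu, forall t, `|beta t| <= c * `|x - t|} -> - pi < x < pi ->
  mu.-integrable I (EFin \o marcinkiewicz_kernel c (fun t => `|beta t|) x) ->
  forall C r theta, stolz_seq C x r theta ->
  (\int[mu]_(t in I) (beta t * conj_poisson_deriv (r n) (theta n - t))) @[n --> \oo] -->
  \int[mu]_(t in I) (beta t * - (1 - cos (x - t))^-1).
Proof.
move=> mb c0 hb xpi ik C r theta hs; have [r01 r1 hq] := hs.
have /andP[x1 x2] := xpi; have p0 := @pi_gt0 R.
have [|k k0 hk] := @one_sub_cos_ge R (pi + `|x|).
  rewrite ltr_wpDr//= mulr_natl mulr2n ltrD2l ltr_norml; apply/andP; split; lra.
have C1 : 0 < 1 + C ^+ 2 by rewrite ltr_wpDr ?sqr_ge0.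
pose c1 := k / (1 + C ^+ 2); have c10 : 0 < c1 by rewrite divr_gt0.
have xt t : I t -> k * (x - t) ^+ 2 <= 1 - cos (x - t).
  rewrite /= in_itv /= => It; apply: hk.
  by rewrite (le_trans (ler_normB _ _))// addrC lerD2r ler_norml.
have ig : mu.-integrable I (EFin \o (fun t =>
    12 / c1 * marcinkiewicz_kernel c (fun t => `|beta t|) x t)) by exact: RintegrableZl.
have cr (y : R) : continuous (fun t : R => y - t).
  by move=> t; apply: cvgB; [exact: cvg_cst|exact: cvg_id].
have [|||||_ _] := @Rdominated_convergence R I
  (fun n t => beta t * conj_poisson_deriv (r n) (theta n - t))
  (fun t => beta t * - (1 - cos (x - t))^-1) _ _ _ _ _ ig => //.
- move=> n; apply: measurable_funM; first exact: measurable_funTS.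
  apply: continuous_measurable.
  exact: continuous_reflect (continuous_conj_poisson_deriv (r01 n)).
- apply: measurable_funTS; apply: measurable_funM => //.
  apply: measurableT_comp => //; apply: (measurableT_comp (@measurable_inv R)).
  apply: measurable_funB => //; apply: continuous_measurable.
  exact: continuous_reflect (@continuous_cos R).
- apply: lebesgue_ae_imply hb => t bt It.
  have [xE|xt0] := eqVneq t x.
    have -> : beta t = 0.
      by apply/eqP; rewrite -normr_le0 (le_trans bt)// xE subrr normr0 mulr0.
    by under eq_fun do rewrite mul0r; rewrite mul0r; exact: cvg_cst.
  apply: cvgM; first exact: cvg_cst.
  apply: conj_poisson_deriv_cvg hs _; rewrite -subr_eq0 -oppr_eq0 opprB.
  apply: lt0r_neq0; apply: lt_le_trans (xt t It).
  rewrite mulr_gt0// lt_neqAle sqr_ge0 andbT eq_sym sqrf_eq0 subr_eq0 eq_sym.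
  exact: xt0.
- apply: lebesgue_ae_imply hb => t bt n It.
  rewrite normrM /marcinkiewicz_kernel.
  have [->|b0] := eqVneq `|beta t| 0; first by rewrite !mul0r mulr0.
  have {}b0 : 0 < `|beta t| by rewrite lt_neqAle eq_sym b0 /=.
  set b := `|beta t| in bt b0 *.
  have q0 := poisson_den_gt0 (theta n - t) (r01 n).
  have /andP[rn0 _] := r01 n.
  have qx : c1 * (x - t) ^+ 2 <= poisson_den (r n) (theta n - t).
    rewrite /c1 mulrAC ler_pdivrMr// [leRHS]mulrC.
    by apply: le_trans (poisson_den_stolz t rn0 (hq n)); exact: xt.
  have bc : (b / c) ^+ 2 <= (x - t) ^+ 2.
    rewrite -(real_normK (num_real (x - t))) lerXn2r ?nnegrE//.
      by rewrite divr_ge0 ?ltW.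
    by rewrite ler_pdivrMr// mulrC.
  have bc0 : 0 < (b / c) ^+ 2 by rewrite exprn_gt0// divr_gt0.
  have D0 : 0 < (x - t) ^+ 2 + (b / c) ^+ 2 by rewrite ltr_wpDl ?sqr_ge0.
  rewrite mulrCA ler_pM2l//.
  apply: (le_trans (conj_poisson_deriv_le _ (r01 n))).
  rewrite ler_pdivrMr// mulrAC ler_pdivlMr// mulrAC ler_pdivlMr//.
  move: qx bc; move: ((x - t) ^+ 2) ((b / c) ^+ 2) (poisson_den _ _) => X B q qx bc.
  have := ler_wpM2l (ltW c10) bc; nra.
Qed.

End StolzLimit.

Section StolzLimitAe.
Context {R : realType}.
Notation mu := (@lebesgue_measure R).
Notation I := (`[- pi, pi]%classic : set R).
Variables (Phi : R -> R) (M : R).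
Hypothesis PhiM : forall t, `|Phi t| <= M.
Hypothesis Phi_periodic : periodic Phi (2 * pi).
Hypothesis lipschitz_ae : mu.-negligible (~` lipschitz_set Phi).

Let Phi0 := Phi \_ (lipschitz_set Phi).

Definition has_stolz_limit (x : R) : Prop := exists l : R,
  forall C (r theta : R^nat), stolz_seq C x r theta ->
  (\int[mu]_(t in I) (Phi0 t * conj_poisson_deriv (r n) (theta n - t))) @[n --> \oo] --> l.

Lemma poisson_stolz_cvg (v : R -> R) C x (r theta : R^nat) :
  mu.-integrable I (EFin \o v) -> - pi < x < pi -> lebesgue_pt (v \_ I) x ->
  stolz_seq C x r theta ->
  (\int[mu]_(t in I) (v t * poisson (r n) (theta n - t))) @[n --> \oo] --> 2 * pi * v x.
Proof.
move=> iv xpi lx [r01 r1 hq]; apply/cvgrPdist_le => e e0.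
have [d d0 hd] := poisson_fatou C iv xpi lx e0.
have /cvgrPdist_lt/(_ _ d0) := r1; apply: filterS => n.
have /andP[_ rn1] := r01 n; rewrite ger0_norm ?subr_ge0 ?(ltW rn1)// => rd.
by rewrite distrC; exact: hd.
Qed.

Lemma has_stolz_limit_lipschitz_pt N :
  {ae mu, forall x, - pi < x < pi -> lipschitz_pt Phi N x -> has_stolz_limit x}.
Proof.
have [N0|] := pselect (lipschitz_pt Phi N !=set0); last first.
  move=> N0; apply: aeW => x _ hx.
  by exfalso; apply: N0; exists x.
have [G [GL GM Gpi GE Gd]] := lipschitz_extension PhiM Phi_periodic N0.
have [v iv vE] := integral_lipschitz_conj_poisson_deriv GL GM Gpi.
have mPhi0 : measurable_fun setT Phi0 := measurable_restrict_lipschitz_set PhiM Phi_periodic.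
have cG := lipschitz_continuous GL.
have mG : measurable_fun setT G by exact: continuous_measurable.
pose beta t := Phi0 t - G t.
have mb : measurable_fun setT beta by exact: measurable_funB.
pose c : R := 2 * N%:R + 1; have c0 : 0 < c by rewrite ltr_wpDl ?mulr_ge0.
have mk := marcinkiewicz_ae c0 (measurableT_comp (@normr_measurable R setT) mb)
  (fun t => normr_ge0 (beta t)).
have lv : {ae mu, forall x, lebesgue_pt (v \_ I) x}.
  apply: lebesgue_differentiation; apply: open_integrable_locally; first exact: openT.
  rewrite -restrict_EFin; apply/integrable_restrict => //; by rewrite setTI.
have Aae : {ae mu, forall t, lipschitz_set Phi t} by exact: lipschitz_ae.
apply: lebesgue_ae_imply (lebesgue_ae_and mk lv) => x [ikx lx] xpi Ex.
have Ix : I x by move: xpi => /andP[x1 x2]; rewrite /= in_itv /= !ltW.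
have bx : {ae mu, forall t, `|beta t| <= c * `|x - t|}.
  apply: lebesgue_ae_imply Aae => t At.
  rewrite /beta /Phi0 patchE mem_set//; apply: (le_trans (Gd x t Ex)).
  by rewrite ler_wpM2r// /c lerDl.
have lim := marcinkiewicz_limit mb c0 bx xpi (ikx Ix).
exists (2 * pi * v x + \int[mu]_(t in I) (beta t * - (1 - cos (x - t))^-1)).
move=> C r theta hs; have [r01 _ _] := hs.
have -> : (fun n => \int[mu]_(t in I) (Phi0 t * conj_poisson_deriv (r n) (theta n - t))) =
  (fun n => \int[mu]_(t in I) (v t * poisson (r n) (theta n - t)) +
    \int[mu]_(t in I) (beta t * conj_poisson_deriv (r n) (theta n - t))).
  apply/funext => n.
  have cK := continuous_reflect (theta := theta n) (continuous_conj_poisson_deriv (r01 n)).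
  have iK := continuous_segment_integrable (- pi) pi cK.
  rewrite -vE// -RintegralD//.
  - by apply: eq_Rintegral => t _; rewrite /beta; ring.
  - apply: continuous_segment_integrable => t.
    by apply: cvgM; [exact: cG|exact: cK].
  - apply: (@Rintegrable_bddM _ I beta _ (M + M)) => //; first exact: measurable_funTS.
    move=> t _; rewrite (le_trans (ler_normB _ _))// lerD// /Phi0 patchE.
    by case: ifP => // _; rewrite normr0 (le_trans _ (PhiM 0)).
by apply: cvgD; [exact: (poisson_stolz_cvg iv xpi lx hs)|exact: lim hs].
Qed.

Lemma has_stolz_limit_ae : {ae mu, forall x, - pi < x < pi -> has_stolz_limit x}.
Proof.
have h := @ae_foralln _ _ _ mu _ has_stolz_limit_lipschitz_pt.
have Aae : {ae mu, forall t, lipschitz_set Phi t} by exact: lipschitz_ae.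
apply: lebesgue_ae_imply (lebesgue_ae_and h Aae) => x [hx [N _ Ex]] xpi.
exact: hx xpi Ex.
Qed.

End StolzLimitAe.

Section ComplexDisk.
Context {R : realType}.
Implicit Types (z zeta : R[i]) (x theta : R).
Local Open Scope complex_scope.

Lemma Re_normc z : complex.Re `|z| = Num.sqrt (complex.Re z ^+ 2 + complex.Im z ^+ 2).
Proof. by rewrite normc_def. Qed.

Lemma unit_diskE z : unit_disk z <-> complex.Re z ^+ 2 + complex.Im z ^+ 2 < 1.
Proof.
rewrite /unit_disk /= normc_def ltcR -(@ltr_pXn2r _ 2)// ?nnegrE ?sqrtr_ge0//.
by rewrite sqr_sqrtr ?expr1n// addr_ge0// sqr_ge0.
Qed.

Lemma cargE z : complex.Re z = complex.Re `|z| * cos (carg z) /\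
  complex.Im z = complex.Re `|z| * sin (carg z).
Proof.
have [theta hth] : exists theta, z = `|z| * expi theta.
  pose a := complex.Re z; pose b := complex.Im z.
  pose rho := Num.sqrt (a ^+ 2 + b ^+ 2).
  have ab0 : 0 <= a ^+ 2 + b ^+ 2 by rewrite addr_ge0// sqr_ge0.
  have rho2 : rho ^+ 2 = a ^+ 2 + b ^+ 2 by rewrite sqr_sqrtr.
  have zE : z = a +i* b by rewrite /a /b; case: (z).
  have nE : `|z| = rho%:C by rewrite normc_def.
  have [rho0|rho0] := eqVneq rho 0.
    exists 0; rewrite nE rho0 mul0r zE.
    move: rho2; rewrite rho0 expr0n /= => /esym/eqP.
    by rewrite paddr_eq0 ?sqr_ge0// !sqrf_eq0 => /andP[/eqP -> /eqP ->].
  have rp : 0 < rho by rewrite lt_neqAle eq_sym rho0 sqrtr_ge0.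
  have sq1 : (a / rho) ^+ 2 + (b / rho) ^+ 2 = 1.
    by rewrite !expr_div_n -mulrDl -rho2 divff// sqrf_eq0.
  have a1 : -1 <= a / rho <= 1.
    rewrite -ler_norml -(@ler_pXn2r _ 2)// ?nnegrE// real_normK ?num_real// expr1n -sq1.
    by rewrite lerDl sqr_ge0.
  have cE : cos (acos (a / rho)) = a / rho by rewrite acosK// in_itv.
  have sE : sin (acos (a / rho)) = `|b / rho|.
    by rewrite sin_acos// -sq1 addrC addKr sqrtr_sqr.
  have fin t : cos t = a / rho -> sin t = b / rho -> z = `|z| * expi t.
    move=> ct st; rewrite nE zE /expi ct st; simpc.
    by rewrite mulrCA divff// mulr1 mulrCA divff// mulr1.
  have [b0|b0] := leP 0 b.
    by exists (acos (a / rho)); apply: fin => //; rewrite sE ger0_norm// divr_ge0// ltW.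
  exists (- acos (a / rho)); apply: fin; rewrite ?cosN ?sinN// sE.
  by rewrite ltr0_norm ?opprK// pmulr_llt0// invr_gt0.
have : z = `|z| * expi (carg z).
  by have := @xgetPex _ 0 [set theta | z = `|z| * expi theta] (ex_intro _ theta hth).
move=> h; split; rewrite [in LHS]h normc_def /expi; simpc; done.
Qed.

Lemma unit_disk_norm z : unit_disk z -> 0 <= complex.Re `|z| < 1.
Proof.
move=> /unit_diskE h; rewrite Re_normc sqrtr_ge0 /= -(@ltr_pXn2r _ 2)// ?nnegrE ?sqrtr_ge0//.
by rewrite sqr_sqrtr ?expr1n// addr_ge0// sqr_ge0.
Qed.

Lemma poisson_den_dist z x : poisson_den (complex.Re `|z|) (carg z - x) =
  (complex.Re z - cos x) ^+ 2 + (complex.Im z - sin x) ^+ 2.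
Proof.
have [-> ->] := cargE z; rewrite /poisson_den cosB.
have := cos2Dsin2 x; have := cos2Dsin2 (carg z).
move: (complex.Re _) (cos _) (sin _) (cos x) (sin x) => r c s c' s' h1 h2.
have -> : (r * c - c') ^+ 2 + (r * s - s') ^+ 2 =
  r ^+ 2 * (c ^+ 2 + s ^+ 2) - 2 * r * (c * c' + s * s') + (c' ^+ 2 + s' ^+ 2) by ring.
by rewrite h1 h2; ring.
Qed.

Lemma sector_stolz x rho0 psi1 psi2 z :
  sector (expi x) rho0 psi1 psi2 `<=` unit_disk -> sector (expi x) rho0 psi1 psi2 z ->
  poisson_den (complex.Re `|z|) (carg z - x) <= (rho0 / 2) ^+ 2 ->
  poisson_den (complex.Re `|z|) (carg z - x) <=
    (4 / rho0) ^+ 2 * (1 - complex.Re `|z|) ^+ 2.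
Proof.
move=> sub sz; have := sz => -[rho [psi [/andP[r0 r1] ppsi zE]]] small.
have rp : 0 < rho0 := lt_trans r0 r1.
pose c := cos (psi - x).
have ReE (k : R) : complex.Re (expi x + k%:C * expi psi) = cos x + k * cos psi.
  by rewrite /expi; simpc.
have ImE (k : R) : complex.Im (expi x + k%:C * expi psi) = sin x + k * sin psi.
  by rewrite /expi; simpc.
have nE (k : R) : (cos x + k * cos psi) ^+ 2 + (sin x + k * sin psi) ^+ 2 =
    1 + 2 * k * c + k ^+ 2.
  rewrite /c cosB; have := cos2Dsin2 x; have := cos2Dsin2 psi.
  move: (cos psi) (sin psi) (cos x) (sin x) => a b a' b' h1 h2.
  have -> : (a' + k * a) ^+ 2 + (b' + k * b) ^+ 2 = (a' ^+ 2 + b' ^+ 2) +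
    2 * k * (a * a' + b * b') + k ^+ 2 * (a ^+ 2 + b ^+ 2) by ring.
  by rewrite h1 h2; ring.
have neg (k : R) : 0 < k < rho0 -> 2 * c < - k.
  move=> /andP[k0 k1].
  have /sub/unit_diskE : sector (expi x) rho0 psi1 psi2 (expi x + k%:C * expi psi).
    by exists k, psi; split => //; rewrite k0.
  rewrite ReE ImE nE => h; rewrite -(ltr_pM2l k0); nra.
have c2 : 2 * c <= - rho0.
  apply/ler_addgt0Pl => e e0; pose k := Num.max (rho0 / 2) (rho0 - e / 2).
  have : 0 < k < rho0.
    by rewrite lt_max gt_max; apply/andP; split; [apply/orP; left; lra|apply/andP; split; lra].
  move/neg; have : rho0 - e / 2 <= k by rewrite le_max lexx orbT.
  lra.
have dE : poisson_den (complex.Re `|z|) (carg z - x) = rho ^+ 2.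
  rewrite poisson_den_dist zE ReE ImE.
  rewrite [cos x + _]addrC [sin x + _]addrC !addrK.
  by have := cos2Dsin2 psi => h; rewrite -[RHS]mulr1 -h; ring.
have zn : complex.Re `|z| ^+ 2 = 1 + 2 * rho * c + rho ^+ 2.
  rewrite Re_normc sqr_sqrtr; last by rewrite addr_ge0// sqr_ge0.
  by rewrite zE ReE ImE nE.
have /andP[q0 q1] := unit_disk_norm (sub _ sz).
have r2 : rho0 / 2 \in Num.nneg by rewrite nnegrE divr_ge0// ltW.
have rn : rho \in Num.nneg by rewrite nnegrE ltW.
move: small; rewrite dE (ler_pXn2r (n := 2))// => small.
have h1 : rho * (- (2 * c) - rho) = 1 - complex.Re `|z| ^+ 2 by rewrite zn; ring.
have h2 : rho * (rho0 / 2) <= rho * (- (2 * c) - rho) by rewrite ler_pM2l//; lra.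
have h3 : rho <= 4 / rho0 * (1 - complex.Re `|z|).
  rewrite mulrAC ler_pdivlMr//.
  by move: h1 h2 q0 q1; move: (complex.Re _) => q h1 h2 q0 q1; nra.
have h4 := le_trans (ltW r0) h3.
by rewrite -exprMn (ler_pXn2r (n := 2)).
Qed.

Lemma path_stolz_seq x (gamma : R -> R[i]^o) : path_to gamma (expi x) ->
  nontangential gamma (expi x) -> forall u : R^nat, (forall n, u n < 1) ->
  u n @[n --> \oo] --> (1 : R) -> exists C n0,
  stolz_seq C x (fun n => complex.Re `|gamma (u (n + n0)%N)|)
    (fun n => carg (gamma (u (n + n0)%N))) /\
  forall n, unit_disk (gamma (u (n + n0)%N)).
Proof.
move=> [cg gd g1] [rho0 [psi1 [psi2 [sub nz]]]] u u1 cu.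
have cgu : gamma (u n) @[n --> \oo] --> (expi x : R[i]^o).
  have [_ _ +] := (continuous_within_itvP gamma (@ltr01 R)).1 cg.
  rewrite g1 => cl; apply: cvg_comp cl.
  move=> A [d /= d0 dA]; have /cvgrPdist_lt/(_ _ d0) := cu.
  by apply: filterS => n h; apply: dA => //=.
have u0 : \forall n \near \oo, 0 <= u n < 1.
  have /cvgrPdist_lt/(_ _ (ltr01)) := cu; apply: filterS => n.
  by rewrite ger0_norm ?subr_ge0 ?(ltW (u1 n))// u1 andbT => h; lra.
have dist e : 0 < e -> \forall n \near \oo,
    poisson_den (complex.Re `|gamma (u n)|) (carg (gamma (u n)) - x) <= e ^+ 2.
  move=> e0; have e0C : (0 : R[i]) < e%:C by rewrite ltcR.
  have /cvgrPdist_lt/(_ _ e0C) := cgu; apply: filterS => n.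
  rewrite poisson_den_dist normc_def ltcR; case: (gamma (u n)) => a b.
  rewrite /expi; simpc => /= h.
  rewrite -[_ + _ in leLHS]sqr_sqrtr ?addr_ge0 ?sqr_ge0//.
  rewrite ler_pXn2r ?nnegrE ?sqrtr_ge0 ?(ltW e0)//; apply: ltW; apply: le_lt_trans h.
  by rewrite le_eqVlt; apply/orP; left; apply/eqP; congr Num.sqrt; ring.
have sz : \forall n \near \oo, sector (expi x) rho0 psi1 psi2 (gamma (u n)).
  have := cgu _ nz; rewrite /= => h; near=> n; have un : 0 <= u n < 1 by near: n.
  have : (gamma @` `[0, 1[) (gamma (u n)) by exists (u n).
  by near: n.
have rho00 : 0 < rho0.
  have [n0 _ /(_ n0 (leqnn n0)) [rho [_ [/andP[a b] _ _]]]] := sz.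
  exact: lt_trans a b.
have [n0 _ hn0] : \forall n \near \oo, 0 <= u n < 1 /\
    poisson_den (complex.Re `|gamma (u n)|) (carg (gamma (u n)) - x) <= (rho0 / 2) ^+ 2 /\
    sector (expi x) rho0 psi1 psi2 (gamma (u n)).
  have := dist _ (divr_gt0 rho00 (ltr0n R 2)) => d.
  near=> n; split; first by near: n.
  by split; near: n.
have hn n : 0 <= u (n + n0)%N < 1 /\
    poisson_den (complex.Re `|gamma (u (n + n0)%N)|) (carg (gamma (u (n + n0)%N)) - x) <=
      (rho0 / 2) ^+ 2 /\
    sector (expi x) rho0 psi1 psi2 (gamma (u (n + n0)%N)).
  by apply: hn0 => /=; exact: leq_addl.
have dk n : unit_disk (gamma (u (n + n0)%N)) by have [] := hn n => /gd.
exists (4 / rho0), n0; split => //; split.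
- by move=> n; exact: unit_disk_norm.
- apply/cvgrPdist_le => e e0; have [n1 _ hn1] := dist _ e0.
  exists n1 => // n /= n1n; have /andP[q0 q1] := unit_disk_norm (dk n).
  rewrite ger0_norm ?subr_ge0 ?(ltW q1)//.
  rewrite -(ler_pXn2r (n := 2))// ?nnegrE ?subr_ge0 ?(ltW q1) ?(ltW e0)//.
  apply: le_trans (poisson_den_ge (carg (gamma (u (n + n0)%N)) - x) q0) _.
  by apply: hn1 => /=; exact: leq_trans n1n (leq_addr _ _).
- by move=> n; have [_ [h1 h2]] := hn n; exact: sector_stolz sub h2 h1.
Unshelve. all: by end_near. Qed.

End ComplexDisk.

Section CircleAe.
Context {R : realType}.
Notation mu := (@lebesgue_measure R).

Lemma expi_periodic : periodic (@expi R) (2 * pi).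
Proof. by move=> x; rewrite /expi [2 * pi]mulr_natl sinD2pi cosD2pi. Qed.

Lemma expiD2npi (x : R) n : expi (x + (2 * pi) * n%:R) = expi x.
Proof. by rewrite mulr_natr periodicn//; exact: expi_periodic. Qed.

Lemma circle_ae_open_period (P : R[i] -> Prop) :
  {ae mu, forall x, - pi < x < pi -> P (expi x)} -> circle_ae P.
Proof.
move=> hP; pose B : set R := [set x | (- pi <= x < pi) /\ ~ P (expi x)].
have nB : mu.-negligible B.
  apply: (@negligibleS _ _ _ mu (~` [set x | - pi < x < pi -> P (expi x)] `|` [set (- pi)])).
    move=> x [/andP[x1 x2] nPx]; have [->|xpi] := eqVneq x (- pi); first by right.
    by left => /= h; apply: nPx; apply: h; rewrite lt_neqAle eq_sym xpi x1.
  apply: negligibleU; first exact: hP.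
  apply/negligibleP; [exact: measurable_set1|exact: lebesgue_measure_set1].
have p0 := @pi_gt0 R; have p20 : 0 < 2 * pi :> R by rewrite mulr_gt0.
apply: (@negligibleS _ _ _ mu (\bigcup_n ([set x | B (x - 2 * pi * n%:R)] `|`
    [set x | B (x - - (2 * pi * n%:R))]))); last first.
  by apply: negligible_bigcup => n; apply: negligibleU; exact: negligible_translate.
move=> x /= nPx; pose k := Num.floor ((x + pi) / (2 * pi)).
have := floor_itv ((x + pi) / (2 * pi)); rewrite -/k => /andP[k1 k2].
have {}k1 : k%:~R * (2 * pi) <= x + pi by rewrite -ler_pdivlMr.
have {}k2 : x + pi < (k + 1)%:~R * (2 * pi) by rewrite -ltr_pdivrMr.
rewrite intrD mulrDl mul1r in k2.
case: k k1 k2 => n k1 k2.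
  exists n => //; left; split.
    by rewrite pmulrn mulrC; apply/andP; split; lra.
  by rewrite -(expiD2npi _ n) subrK.
exists n.+1 => //; right; rewrite NegzE mulrNz -pmulrn in k1 k2; split.
  by rewrite mulrC; apply/andP; split; lra.
by rewrite opprK expiD2npi.
Qed.

End CircleAe.

Theorem corollary5 (R : realType) (Phi : R -> R)
  (Phi_periodic : periodic Phi (2 * pi))
  (Phi_bounded : exists M : R, forall t : R, `|Phi t| <= M)
  (Phi_derivable_ae :
    {ae (@lebesgue_measure R), forall t : R, derivable Phi t 1}) :
  (forall r theta : R, 0 <= r < 1 ->
     RSintegrable (fun t : R => conj_poisson r (theta - t)) Phi (- pi) pi) /\
  exists phi : R[i] -> R,
    circle_ae (fun zeta : R[i] =>
      forall gamma : R -> R[i]^o,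
        path_to gamma zeta -> nontangential gamma zeta ->
        conj_poisson_stieltjes Phi (gamma s) @[s --> (1 : R)^'-] --> phi zeta).
Proof.
have [M PhiM] := Phi_bounded.
have nA : (@lebesgue_measure R).-negligible (~` lipschitz_set Phi).
  apply: negligibleS Phi_derivable_ae => t /= nt dt; apply: nt.
  by have [N hN] := derivable_lipschitz_pt PhiM dt; exists N.
have mPhi := measurable_restrict_lipschitz_set PhiM Phi_periodic.
have cPhi x : lipschitz_set Phi x -> {for x, continuous Phi}.
  by move=> [N _]; exact: lipschitz_pt_continuous.
have Phipi : Phi pi = Phi (- pi).
  by rewrite -(Phi_periodic (- pi)); congr Phi; ring.
have isRS r theta (r01 : 0 <= r < 1) :=
  is_RSint_conj_poisson theta Phipi mPhi nA cPhi PhiM r01.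
have VE z : unit_disk z -> conj_poisson_stieltjes Phi z = (2 * pi)^-1 *
    (\int[@lebesgue_measure R]_(t in `[- pi, pi]) ((Phi \_ (lipschitz_set Phi)) t *
      conj_poisson_deriv (complex.Re `|z|) (carg z - t))).
  move=> /unit_disk_norm r01; congr (_ * _).
  apply: (is_RSint_unique (@oppi_le_pi R) _ (isRS _ _ r01)).
  by apply: (@xgetPex _ 0 [set l | is_RSint _ Phi (- pi) pi l]); eexists; exact: isRS.
split; first by move=> r theta r01; eexists; exact: isRS.
pose lim (zeta : R[i]) (l : R) := forall gamma : R -> R[i]^o,
  path_to gamma zeta -> nontangential gamma zeta ->
  conj_poisson_stieltjes Phi (gamma s) @[s --> (1 : R)^'-] --> l.
exists (fun zeta => xget 0 [set l | lim zeta l]).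
apply: circle_ae_open_period.
apply: lebesgue_ae_imply (has_stolz_limit_ae PhiM Phi_periodic nA) => x + xpi.
move=> /(_ xpi) [l hl].
suff : lim (expi x) ((2 * pi)^-1 * l).
  by move=> h; apply: (@xgetPex _ 0 [set l | lim (expi x) l]); eexists; exact: h.
move=> gamma pg ng; apply/cvg_at_leftP => u [u1 cu].
have [C [n0 [hs hd]]] := path_stolz_seq pg ng u1 cu.
rewrite -(cvg_shiftn n0) /=.
under eq_fun do rewrite VE//.
by apply: cvgM; [exact: cvg_cst|exact: hl hs].
Qed.
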